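(* Let $g \geq 3$ and let $\Gamma$ be a loop of loops of genus $g$, with trivalent vertices $v_1, w_1, \ldots, v_{g-1}, w_{g-1}$. Then the set $\{v_1, w_1, \ldots, v_{g-1}, w_{g-1}\}$ is a minimal rank determining set on $\Gamma$; that is, it is rank determining and no proper subset of it is rank determining.
   Context: Metric graphs. A metric graph is a compact connected metric space obtained from a finite connected graph (loops and multiple edges allowed) by assigning a positive real length to each edge. Its genus is its first Betti number. Loops of loops. For $g \geq 3$, a loop of loops of genus $g$ is a trivalent metric graph with $2g-2$ vertices $v_1, \ldots, v_{g-1}, w_1, \ldots, w_{g-1}$ and exactly the following edges, of arbitrary positive lengths: a single edge joining $v_i$ to $w_i$ for $1 \leq i \leq g-1$, two edges joining $w_i$ to $v_{i+1}$ for $1 \leq i \leq g-2$, and two edges joining $w_{g-1}$ to $v_1$. Divisors. A divisor on a metric graph $\Gamma$ is a finite $\mathbb{Z}$-linear combination of points of $\Gamma$; its degree is the sum of its coefficients; it is effective if all its coefficients are nonnegative. For a continuous piecewise linear function $f$ on $\Gamma$ with integer slopes, $\mathrm{div}(f) = \sum_{v \in \Gamma} \mathrm{ord}_v(f)\, v$, where $\mathrm{ord}_v(f)$ is the sum of the incoming slopes of $f$ at $v$; such divisors are called principal. Two divisors are equivalent if their difference is principal. Rank determining sets. For a subset $A \subset \Gamma$ and a divisor $D$, the $A$-rank $r_A(D)$ is $-1$ if $D$ is not equivalent to an effective divisor, and otherwise is the largest integer $r$ such that for every effective divisor $E$ of degree $r$ with support in $A$ there is a divisor $D'$ equivalent to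 $D$ with $D' - E$ effective. The rank is $r(D) = r_\Gamma(D)$. The subset $A$ is rank determining if $r_A(D) = r(D)$ for all divisors $D$ on $\Gamma$. *)

(* Defs.v *)
From HB Require Import structures.
From mathcomp Require Import all_boot all_order all_algebra.
From mathcomp Require Import boolp classical_sets reals.
From mathcomp Require Export freeg.

Set Implicit Arguments.
Unset Strict Implicit.
Unset Printing Implicit Defensive.

Import Order.TTheory GRing.Theory Num.Theory.

Local Open Scope classical_set_scope.
Local Open Scope ring_scope.

(* A finite connected multigraph with positive edge lengths. The orientation
   src -> tgt only serves to parametrize each edge by [0, len e]; loops and
   multiple edges are allowed. *)
Record metric_graph (R : realType) := MetricGraph {
  vertex : finType;
  edge : finType;
  src : edge -> vertex;
  tgt : edge -> vertex;
  len : edge -> R;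
  len_gt0 : forall e, 0 < len e;
  vertex_nonempty : (0 < #|vertex|)%N;
  graph_connected : forall x y : vertex,
    connect (fun a b => [exists e, ((src e == a) && (tgt e == b))
                                || ((src e == b) && (tgt e == a))]) x y
}.

Section MetricGraph.
Variables (R : realType) (G : metric_graph R).

(* First Betti number; no truncation occurs since G is connected. *)
Definition genus : nat := (#|edge G|.+1 - #|vertex G|)%N.

Definition valence (v : vertex G) : nat :=
  (#|[pred e : edge G | src e == v]| + #|[pred e : edge G | tgt e == v]|)%N.

Definition is_gpoint (p : vertex G + edge G * R) : bool :=
  if p is inr (e, t) then 0 < t < len e else true.

(* A point is either a vertex or a position t, 0 < t < len e, inside an edge e. *)
Record gpoint : Type := GPoint {
  gpoint_val : vertex G + edge G * R;
  _ : is_gpoint gpoint_val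
}.

HB.instance Definition _ := [isSub for gpoint_val].
HB.instance Definition _ := [Choice of gpoint by <:].

Definition vpoint (v : vertex G) : gpoint := GPoint (isT : is_gpoint (inl v)).

(* The parametrization of e by [0, len e], extended by constants to R. *)
Definition epoint (e : edge G) (t : R) : gpoint :=
  insubd (vpoint (if t <= 0 then src e else tgt e)) (inr (e, t)).

Definition affine_on (h : R -> R) (a b : R) : Prop :=
  exists m : int, forall t, a <= t <= b -> h t = h a + m%:~R * (t - a).

(* Consecutive closed pieces share an endpoint, so continuity on [0, l] is
   built in. *)
Definition piecewise_affine_on (h : R -> R) (l : R) : Prop :=
  exists s : seq R, [/\ path <%R 0 s, last 0 s = l &
    forall i, (i < size s)%N -> affine_on h (nth 0 (0 :: s) i) (nth 0 s i)].

(* Continuous piecewise linear functions with integer slopes. Continuity at a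
   vertex holds because epoint e sends 0 and len e to the end vertices of e:
   G carries the quotient topology of the disjoint union of the [0, len e]. *)
Definition pl_function (f : gpoint -> R) : Prop :=
  forall e : edge G, piecewise_affine_on (f \o epoint e) (len e).

(* The slopes are unique when they exist, which is the case at the relevant
   places for pl_functions; the default value 0 is otherwise irrelevant. *)
Definition right_slope (h : R -> R) (t : R) : int :=
  xget 0 [set m : int | exists2 d, 0 < d &
    forall u, t <= u <= t + d -> h u = h t + m%:~R * (u - t)].

Definition left_slope (h : R -> R) (t : R) : int :=
  xget 0 [set m : int | exists2 d, 0 < d &
    forall u, t - d <= u <= t -> h u = h t + m%:~R * (u - t)].

(* Sum of the incoming slopes of f at x. Arriving at a position t of an edge
   from the right, the incoming slope is the opposite of the right slope. A
   loop at a vertex contributes to both sums. *)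
Definition ord (f : gpoint -> R) (x : gpoint) : int :=
  match gpoint_val x with
  | inl v => \sum_(e : edge G | tgt e == v) left_slope (f \o epoint e) (len e)
             - \sum_(e : edge G | src e == v) right_slope (f \o epoint e) 0
  | inr (e, t) => left_slope (f \o epoint e) t - right_slope (f \o epoint e) t
  end.

Definition divisor := {freeg gpoint / int}.

Definition effective (D : divisor) : Prop := forall x, 0 <= coeff x D.

Definition supported_in (A : set gpoint) (D : divisor) : Prop :=
  forall x, coeff x D != 0 -> A x.

Definition principal (D : divisor) : Prop :=
  exists2 f, pl_function f & forall x, coeff x D = ord f x.

Definition equivalent (D D' : divisor) : Prop := principal (D - D').

Definition rank_at_least (A : set gpoint) (D : divisor) (r : int) : Prop :=
  forall E : divisor, effective E -> deg E = r -> supported_in A E ->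
    exists2 D', equivalent D' D & effective (D' - E).

(* r_A(D) = r, as a relation: if A is empty and D is equivalent to an effective
   divisor, there is no largest r and r_A(D) has no value. *)
Definition is_Arank (A : set gpoint) (D : divisor) (r : int) : Prop :=
  (~ (exists2 D', equivalent D' D & effective D') /\ r = -1) \/
  [/\ exists2 D', equivalent D' D & effective D',
      rank_at_least A D r &
      forall s : int, rank_at_least A D s -> s <= r].

Definition is_rank (D : divisor) (r : int) : Prop := is_Arank [set: gpoint] D r.

Definition rank_determining (A : set gpoint) : Prop :=
  forall D : divisor, exists r, is_Arank A D r /\ is_rank D r.

Definition minimal_rank_determining (A : set gpoint) : Prop :=
  rank_determining A /\ forall B : set gpoint, B `<` A -> ~ rank_determining B.

End MetricGraph.

Section LoopOfLoops.
Variables (R : realType) (g : nat).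

(* With 0-based indices i : 'I_g.-1, the vertex inl i is v_(i+1) and the vertex
   inr i is w_(i+1). *)
Definition lol_vertex : finType := ('I_g.-1 + 'I_g.-1)%type.

(* The edge inl i joins v_i to w_i; the edges inr (i, b), b : bool, join w_i to
   v_(i+1), with indices taken cyclically (ordS). *)
Definition lol_edge : finType := ('I_g.-1 + 'I_g.-1 * bool)%type.

Definition lol_src (e : lol_edge) : lol_vertex :=
  match e with inl i => inl i | inr (i, _) => inr i end.

Definition lol_tgt (e : lol_edge) : lol_vertex :=
  match e with inl i => inr i | inr (i, _) => inl (ordS i) end.

Lemma lol_nonempty : (3 <= g)%N -> (0 < #|lol_vertex|)%N.
Proof. by rewrite card_sum card_ord; case: g => [|[|n]]. Qed.

Lemma lol_connected (x y : lol_vertex) :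
  connect (fun a b => [exists e, ((lol_src e == a) && (lol_tgt e == b))
                              || ((lol_src e == b) && (lol_tgt e == a))]) x y.
Proof.
set r := (fun a b => _).
have rsym : connect_sym r.
  apply: sym_connect_sym => a b; rewrite /r.
  by apply/eq_existsb => e; rewrite orbC.
have vw i : connect r (inl i) (inr i).
  by apply/connect1/existsP; exists (inl i); rewrite !eqxx.
have wv i : connect r (inr i) (inl (ordS i)).
  by apply/connect1/existsP; exists (inr (i, true)); rewrite !eqxx.
have vv k (i j : 'I_g.-1) : i = k :> nat -> connect r (inl j) (inl i) ->
    forall m (l : 'I_g.-1), l = (k + m)%N :> nat -> connect r (inl j) (inl l).
  move=> ik ji; elim=> [|m IH] l lm.
    by rewrite (_ : l = i) //; apply: val_inj; rewrite /= lm ik addn0.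
  have kmg : (k + m < g.-1)%N.
    by apply: leq_trans (ltn_ord l); rewrite lm addnS leqW.
  apply: connect_trans (IH (Ordinal kmg) erefl) _.
  apply: connect_trans (vw _) _.
  rewrite (_ : l = ordS (Ordinal kmg)) //; apply: val_inj => /=.
  by rewrite modn_small ?lm ?addnS // -addnS -lm ltn_ord.
have up (i j : 'I_g.-1) : (i <= j)%N -> connect r (inl i) (inl j).
  move=> ij; apply: (vv i i i erefl (connect0 _ _) (j - i)%N).
  by rewrite subnKC.
have all_v i j : connect r (inl i) (inl j).
  by case/orP: (leq_total i j) => /up //; rewrite rsym.
have toV z : exists i, connect r z (inl i).
  by case: z => i; [exists i | exists (ordS i)].
have [i xi] := toV x; have [j yj] := toV y.
apply: connect_trans xi (connect_trans (all_v i j) _).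
by rewrite rsym.
Qed.

Definition loop_of_loops (hg : (3 <= g)%N) (l : lol_edge -> R)
    (l_gt0 : forall e, 0 < l e) : metric_graph R :=
  @MetricGraph R lol_vertex lol_edge lol_src lol_tgt l l_gt0
    (lol_nonempty hg) lol_connected.

Section Points.
Variables (hg : (3 <= g)%N) (l : lol_edge -> R) (l_gt0 : forall e, 0 < l e).
Let G := loop_of_loops hg l_gt0.

Definition lol_v (i : 'I_g.-1) : gpoint G := vpoint (inl i : vertex G).
Definition lol_w (i : 'I_g.-1) : gpoint G := vpoint (inr i : vertex G).

Definition lol_vertices : set (gpoint G) :=
  [set x | exists i, x = lol_v i \/ x = lol_w i].

Lemma lol_genus : genus G = g.
Proof.
rewrite /genus !card_sum card_prod card_bool card_ord.
by rewrite muln2 -addnn addnA -addnS addnC addnK prednK // (leq_trans _ hg).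
Qed.

Lemma lol_trivalent (v : vertex G) : valence v = 3.
Proof.
have fib1 (P : pred (edge G)) e : P =1 pred1 e -> #|P| = 1%N.
  by move=> /eq_card ->; rewrite card1.
have fib2 (P : pred (edge G)) k :
    (forall j, P (inl j) = false) -> (forall j b, P (inr (j, b)) = (j == k)) ->
    #|P| = 2%N.
  move=> Pl Pr; rewrite (@eq_card _ _ (pred2 (inr (k, true)) (inr (k, false)))).
    by rewrite card2 (inj_eq inr_inj) xpair_eqE andbF.
  case=> [j|[j b]]; rewrite !inE /in_mem /= ?Pl ?Pr //.
  by rewrite !(inj_eq inr_inj) !xpair_eqE -andb_orr; case: b; rewrite andbT.
rewrite /valence; case: v => i.
  rewrite (fib1 _ (inl i)); last by case=> [j|[j b]].
  rewrite (fib2 _ (ord_pred i)) // => j b.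
  by apply: (can2_eq (@ordSK _) (@ord_predK _)).
by rewrite (fib2 _ i) // (fib1 _ (inl i)) //; case=> [j|[j b]].
Qed.

End Points.
End LoopOfLoops.

Arguments lol_v {R g} hg {l} l_gt0 i.
Arguments lol_w {R g} hg {l} l_gt0 i.
Arguments lol_vertices {R g} hg {l} l_gt0 _.

(* Main.v *)
Require Import Defs.
From mathcomp Require Import all_boot all_order all_algebra.
From mathcomp Require Import boolp classical_sets reals.
From mathcomp Require Import ring lra zify.

(* Rank determining: let u, w be the distinct ends of an edge e, and let D1 and
   D2 = D1 + div f be effective with a chip at u and at w respectively. For x in
   e and c = f x, the divisor D1 + div (min f c) is effective and has chips on e
   on both sides of x, which can be moved towards each other until one of them
   reaches x. Hence a class that can reach all vertices can reach every point,
   and an induction on the degree turns this into equality of ranks.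

   Minimality: starting from the removed vertex y_0, number the vertices
   cyclically y_0, ..., y_(2k-1) so that y_(2m), y_(2m+1) are joined by two edges
   and y_(2m+1), y_(2m+2) by one. Let D have one chip on each odd vertex, and a
   second one on y_(2k-1). By Dhar's burning algorithm the fire started at y_0
   burns y_1, y_2, ... in turn, so D is not equivalent to an effective divisor
   with a chip at y_0. On the other hand each y_(2j) with j > 0 can be reached:
   the chips of y_(2k-1) travel down to y_(2j) while the chip of y_(2j-1) crosses
   the single edge from the other side, until one of them arrives. *)

Set Implicit Arguments.
Unset Strict Implicit.
Unset Printing Implicit Defensive.

Import Order.TTheory GRing.Theory Num.Theory.

Local Open Scope ring_scope.

(** * One-sided slopes of piecewise affine functions *)

Section Germs.
Variable R : realType.
Implicit Types (h k : R -> R) (t l : R) (m n : int).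

Definition right_germ h t m : Prop := exists2 d : R, 0 < d &
  forall u, t <= u <= t + d -> h u = h t + m%:~R * (u - t).

Definition left_germ h t m : Prop := exists2 d : R, 0 < d &
  forall u, t - d <= u <= t -> h u = h t + m%:~R * (u - t).

(** On a common interval both functions are affine, so comparing them at its right end compares the
    slopes. *)
Lemma right_germ_le h k t m n : right_germ h t m -> right_germ k t n ->
  h t = k t -> (exists2 d : R, 0 < d & forall u, t <= u <= t + d -> h u <= k u) ->
  m <= n.
Proof.
case=> d1 d1_gt0 h1 [d2 d2_gt0 h2] htk [d3 d3_gt0 h3].
pose d := Num.min d1 (Num.min d2 d3).
have d_gt0 : 0 < d by rewrite !lt_min d1_gt0 d2_gt0.
have [dd1 dd2 dd3] : [/\ d <= d1, d <= d2 & d <= d3].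
  by split; rewrite !ge_min lexx ?orbT.
move: d d_gt0 dd1 dd2 dd3 => d d_gt0 dd1 dd2 dd3.
have : h (t + d) <= k (t + d) by apply: h3; lra.
rewrite h1; [rewrite h2; last lra|lra].
by rewrite htk [t + d - t]addrC addKr lerD2l ler_pM2r // ler_int.
Qed.

Lemma right_germ_uniq h t m n : right_germ h t m -> right_germ h t n -> m = n.
Proof.
move=> hm hn; apply/eqP; rewrite eq_le.
by rewrite (right_germ_le hm hn) ?(right_germ_le hn hm) //; exists 1.
Qed.

(** Reflection at the origin makes statements about left germs follow from those about right
    germs. *)
Lemma germ_reflect h t m :
  left_germ h t m <-> right_germ (fun u => h (- u)) (- t) (- m).
Proof.
split=> -[d d_gt0 hd]; exists d => // u hu.
  by rewrite hd ?opprK ?rmorphN /=; lra.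
by rewrite -[u]opprK hd ?opprK ?rmorphN /=; lra.
Qed.

Lemma left_germ_le h k t m n : left_germ h t m -> left_germ k t n ->
  h t = k t -> (exists2 d : R, 0 < d & forall u, t - d <= u <= t -> k u <= h u) ->
  m <= n.
Proof.
move=> /germ_reflect hm /germ_reflect kn htk [d d0 hk].
rewrite -lerN2; apply: (right_germ_le kn hm); first by rewrite opprK.
by exists d => // u hu; apply: hk; lra.
Qed.

Lemma left_germ_uniq h t m n : left_germ h t m -> left_germ h t n -> m = n.
Proof.
by move=> /germ_reflect hm /germ_reflect hn; apply/oppr_inj/(right_germ_uniq hm).
Qed.

Lemma right_slopeE h t m : right_germ h t m -> right_slope h t = m.
Proof.
by move=> hm; apply: (right_germ_uniq _ hm); rewrite /right_slope;
  case: xgetP => [? _ //|/(_ m)].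
Qed.

Lemma left_slopeE h t m : left_germ h t m -> left_slope h t = m.
Proof.
by move=> hm; apply: (left_germ_uniq _ hm); rewrite /left_slope;
  case: xgetP => [? _ //|/(_ m)].
Qed.

Lemma right_germ_affine h t a b m : a <= t < b ->
  (forall u, a <= u <= b -> h u = h a + m%:~R * (u - a)) -> right_germ h t m.
Proof.
move=> tab hab; exists (b - t) => [|u hu]; first lra.
by rewrite [h u]hab; [rewrite [h t]hab|]; lra.
Qed.

Lemma left_germ_affine h t a b m : a < t <= b ->
  (forall u, a <= u <= b -> h u = h a + m%:~R * (u - a)) -> left_germ h t m.
Proof.
move=> tab hab; exists (t - a) => [|u hu]; first lra.
by rewrite [h u]hab; [rewrite [h t]hab|]; lra.
Qed.

Lemma right_germB h k t m n : right_germ h t m -> right_germ k t n ->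
  right_germ (fun u => h u - k u) t (m - n).
Proof.
case=> d1 d1_gt0 h1 [d2 d2_gt0 h2].
pose d := Num.min d1 d2.
have [dd1 dd2] : d <= d1 /\ d <= d2 by split; rewrite !ge_min lexx ?orbT.
have d_gt0 : 0 < d by rewrite !lt_min d1_gt0 d2_gt0.
move: d d_gt0 dd1 dd2 => d d_gt0 dd1 dd2; exists d => // u hu.
by rewrite h1; [rewrite h2; [rewrite rmorphB /=|]|]; lra.
Qed.

Lemma left_germB h k t m n : left_germ h t m -> left_germ k t n ->
  left_germ (fun u => h u - k u) t (m - n).
Proof.
move=> /germ_reflect hm /germ_reflect kn; apply/germ_reflect.
by rewrite opprB addrC -[n]opprK; apply: right_germB.
Qed.

(** Away from level [c] the function stays on one side of it near [t]; at the level, the minimum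
    takes the smaller of the slopes [m] and 0. *)
Lemma right_germ_min h t m c : right_germ h t m ->
  exists n, right_germ (fun u => Num.min (h u) c) t n.
Proof.
case=> d d_gt0 hd.
have near (q : R) : h t != c -> exists2 d' : R, 0 < d' &
    (d' <= d) /\ `|q| * d' <= `|h t - c|.
  move=> htc; have htc0 : 0 < `|h t - c| by rewrite normr_gt0 subr_eq0.
  have q1 : 0 < `|q| + 1 by rewrite ltr_wpDl.
  exists (Num.min d (`|h t - c| / (`|q| + 1))).
    by rewrite lt_min d_gt0 divr_gt0.
  split; first by rewrite ge_min lexx.
  apply: (@le_trans _ _ ((`|q| + 1) * Num.min d (`|h t - c| / (`|q| + 1)))).
    by rewrite ler_wpM2r ?lerDl // le_min ltW //= divr_ge0 // ltW.
  by rewrite mulrC -ler_pdivlMr // ge_min lexx orbT.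
have bound (q d' u : R) : t <= u <= t + d' -> `|q * (u - t)| <= `|q| * d'.
  by move=> hu; rewrite normrM ler_wpM2l // ger0_norm; lra.
have [htc|htc|htc] := ltgtP (h t) c.
- have [d' d'0 [d'd hd']] := near m%:~R (negbT (lt_eqF htc)).
  exists m, d' => // u hu.
  have := bound m%:~R _ _ hu; rewrite hd; last lra.
  rewrite (ltr0_norm (_ : h t - c < 0)) in hd'; last lra.
  by move=> /(le_trans)/(_ hd'); rewrite ler_norml => ?; rewrite !min_l; lra.
- have [d' d'0 [d'd hd']] := near m%:~R (negbT (gt_eqF htc)).
  exists 0, d' => // u hu; rewrite mul0r addr0.
  have := bound m%:~R _ _ hu; rewrite hd; last lra.
  rewrite (gtr0_norm (_ : 0 < h t - c)) in hd'; last lra.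
  by move=> /(le_trans)/(_ hd'); rewrite ler_norml => ?; rewrite !min_r; lra.
- have [m0|m0] := leP 0 m.
    exists 0, d => // u hu; rewrite hd // -htc mul0r addr0 minxx min_r //.
    by rewrite lerDl mulr_ge0 ?ler0z //; lra.
  exists m, d => // u hu; rewrite hd // -htc minxx min_l //.
  by rewrite gerDl mulr_le0_ge0 ?lerz0; [|exact: ltW|lra].
Qed.

Lemma left_germ_min h t m c : left_germ h t m ->
  exists n, left_germ (fun u => Num.min (h u) c) t n.
Proof.
move=> /germ_reflect /(right_germ_min c) [n hn]; exists (- n).
by apply/germ_reflect; rewrite opprK.
Qed.

(** Recursive form of [piecewise_affine_on] with a free left end, suited to induction on the
    breakpoints. *)
Fixpoint pieces h a (s : seq R) : Prop :=
  if s is b :: s' then [/\ a < b, affine_on h a b & pieces h b s'] else True.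

Lemma pieces_lt h a s : pieces h a s -> a <= last a s.
Proof.
by elim: s a => //= b s IH a [ab _ /IH]; apply: le_trans (ltW ab).
Qed.

Lemma pieces_cat h a s1 s2 :
  pieces h a s1 -> pieces h (last a s1) s2 -> pieces h a (s1 ++ s2).
Proof. by elim: s1 a => //= b s1 IH a [? ? ?] ?; split=> //; apply: IH. Qed.

Lemma piecesP h a s : pieces h a s <-> path <%R a s /\
  forall i, (i < size s)%N -> affine_on h (nth 0 (a :: s) i) (nth 0 s i).
Proof.
elim: s a => [|b s IH] a /=; first by split.
split=> [[ab hb /IH[ps hs]]|[/andP[ab ps] hs]].
  by rewrite ab; split=> // -[|i] // /hs.
split=> //; first exact: (hs 0%N).
by apply/IH; split=> // i; apply: (hs i.+1).
Qed.

Lemma piecewise_affineP h l :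
  piecewise_affine_on h l <-> exists2 s, pieces h 0 s & last 0 s = l.
Proof.
by split=> [[s [? ? ?]]|[s /piecesP[? ?] ?]]; exists s => //; apply/piecesP.
Qed.

(** Local form of piecewise affinity: it passes to differences and minima without refining
    subdivisions. *)
Definition has_germs h l : Prop :=
  (forall t, 0 <= t < l -> exists m, right_germ h t m) /\
  (forall t, 0 < t <= l -> exists m, left_germ h t m).

Lemma pieces_right_germ h a s t : pieces h a s -> a <= t < last a s ->
  exists m, right_germ h t m.
Proof.
elim: s a => [|b s IH] a /=; first by move=> _; lra.
case=> ab [m hm] hs ht; have [tb|bt] := ltP t b.
  by exists m; apply: right_germ_affine hm; lra.
by apply: IH hs _; lra.
Qed.

Lemma pieces_left_germ h a s t : pieces h a s -> a < t <= last a s ->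
  exists m, left_germ h t m.
Proof.
elim: s a => [|b s IH] a /=; first by move=> _; lra.
case=> ab [m hm] hs ht; have [tb|bt] := leP t b.
  by exists m; apply: left_germ_affine hm; lra.
by apply: IH hs _; lra.
Qed.

(** Compactness by a supremum: let [T] be the supremum of the points up to which a finite
    subdivision exists. The left germ shows that [T] is such a point. If [T < l], the right germ
    extends the subdivision past [T], a contradiction, or up to [l]. *)
Lemma has_germs_piecewise h l : 0 < l -> has_germs h l ->
  piecewise_affine_on h l.
Proof.
move=> l0 [hr hl]; apply/piecewise_affineP.
pose E : set R := [set t | t <= l /\ exists2 s, pieces h 0 s & last 0 s = t]%classic.
have E0 : E 0 by split; [exact: ltW | exists [::]].
have Eub : has_ubound E by exists l => t [].
have Esup : has_sup E by split; first by exists 0.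
set T := sup E.
have T0 : 0 <= T by apply: ub_le_sup.
have Tl : T <= l by apply: ge_sup => [|t []]; first by exists 0.
have ET : E T.
  move: T0; rewrite le_eqVlt => /orP[/eqP <- //|T0].
  have [|m [d d0 hd]] := hl T; first lra.
  have [t [tl [s ps ls]] tT] := sup_adherent d0 Esup.
  have tT' : t <= T by apply: ub_le_sup => //; split=> //; exists s.
  split=> //; rewrite -/T in tT.
  move: tT'; rewrite le_eqVlt => /orP[/eqP <-|tT']; first by exists s.
  exists (s ++ [:: T]); last by rewrite last_cat.
  apply: pieces_cat => //=; rewrite ls; split=> //; exists m => u hu.
  rewrite hd; last lra.
  by rewrite (hd t); lra.
case: ET => _ [s ps ls].
have [TL|TL] := ltP T l; last by exists s => //; lra.
have [|m [d d0 hd]] := hr T; first lra.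
have [dl|ld] := leP (T + d) l.
  suff : T + d <= T by lra.
  apply: ub_le_sup => //; split=> //.
  exists (s ++ [:: T + d]); last by rewrite last_cat.
  by apply: pieces_cat => //=; rewrite ls; split; [lra|exists m|].
exists (s ++ [:: l]); last by rewrite last_cat.
apply: pieces_cat => //=; rewrite ls; split=> //; exists m => u hu.
by apply: hd; lra.
Qed.

Lemma piecewise_affine_germs h l : 0 < l ->
  piecewise_affine_on h l <-> has_germs h l.
Proof.
move=> l0; split=> [/piecewise_affineP [s ps <-]|/has_germs_piecewise]; last exact.
by split=> t; [apply: pieces_right_germ|apply: pieces_left_germ].
Qed.

Section HasGerms.
Variables (h : R -> R) (l : R).
Hypothesis hl : has_germs h l.

Lemma right_slope_germ t : 0 <= t < l -> right_germ h t (right_slope h t).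
Proof. by move=> /hl.1[m hm]; rewrite (right_slopeE hm). Qed.

Lemma left_slope_germ t : 0 < t <= l -> left_germ h t (left_slope h t).
Proof. by move=> /hl.2[m hm]; rewrite (left_slopeE hm). Qed.

End HasGerms.

(** Going left from [x], each piece met at level [c] has slope zero, so the level propagates down to
    [a]. *)
Lemma level_left h a s x c : pieces h a s -> a <= x <= last a s -> h x = c ->
  (forall t, a < t <= x -> h t = c -> left_slope h t = 0) -> h a = c.
Proof.
elim: s a x => [|b s IH] a x /=; first by move=> _ ax <- _; congr h; lra.
move=> [ab [m hm] ps] ax hx hc.
have aux y : a < y <= b -> y <= x -> h y = c -> h a = c.
  move=> yab yx hy.
  have : left_slope h y = 0 by apply: hc => //; lra.
  rewrite (left_slopeE (left_germ_affine yab hm)) => m0.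
  by rewrite -hy (hm y) ?m0; lra.
have [xb|bx] := leP x b.
  have [ax'|xa] := ltP a x; first by apply: (aux x) => //; lra.
  by rewrite -hx; congr h; lra.
apply: (aux b); [lra|lra|]; apply: (IH b x ps) => // [|t tb]; first lra.
by apply: hc; lra.
Qed.

Lemma level_right h a s x c : pieces h a s -> a <= x <= last a s -> h x = c ->
  (forall t, x <= t < last a s -> h t = c -> right_slope h t = 0) ->
  h (last a s) = c.
Proof.
elim: s a x => [|b s IH] a x /=; first by move=> _ ax <- _; congr h; lra.
move=> [ab [m hm] ps] ax hx hc; have bl := pieces_lt ps.
have [bx|xb] := leP b x; first by apply: (IH b x ps) => //; lra.
apply: (IH b b ps); [lra| |by move=> t tb; apply: hc; lra].
have xab : a <= x < b by lra.
have : right_slope h x = 0 by apply: hc => //; lra.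
rewrite (right_slopeE (right_germ_affine xab hm)) => m0.
by rewrite -hx (hm b) ?(hm x) ?m0; lra.
Qed.

(** Slopes do not increase across breakpoints, so the slope of the chord lies between the last and
    the first one. *)
Lemma concave_slopes h a b s : let l := last b s in pieces h a (b :: s) ->
  (forall t, a < t < l -> right_slope h t <= left_slope h t) ->
  [/\ left_slope h l <= right_slope h a,
      h l - h a <= (right_slope h a)%:~R * (l - a) &
      (left_slope h l)%:~R * (l - a) <= h l - h a].
Proof.
elim: s a b => [|c s IH] a b /=; move=> [ab [m hm] ps] hc.
  rewrite (left_slopeE (left_germ_affine _ hm)) ?(right_slopeE (right_germ_affine _ hm)) //.
  - by rewrite hm; [split=> //|]; lra.
  - lra.
  - lra.
have bc : b < last c s.
  by case: ps => bc _ /pieces_lt; apply: lt_le_trans.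
have [|] := IH b c ps; first by move=> t tb; apply: hc; lra.
set L := left_slope h _; move=> h1 h2 h3.
have -> : right_slope h a = m by apply: right_slopeE; apply: right_germ_affine hm; lra.
have lb : left_slope h b = m by apply: left_slopeE; apply: left_germ_affine hm; lra.
have hb : right_slope h b <= m by rewrite -lb; apply: hc; lra.
have hmb : h b = h a + m%:~R * (b - a) by apply: hm; lra.
have Lm : L <= m by apply: le_trans hb.
split=> //.
  have : (right_slope h b)%:~R * (last c s - b) <= m%:~R * (last c s - b) :> R.
    by rewrite ler_wpM2r ?ler_int //; lra.
  lra.
have : L%:~R * (b - a) <= m%:~R * (b - a) :> R.
  by rewrite ler_wpM2r ?ler_int //; lra.
lra.
Qed.

(** Both end slopes of a piece agree, so the sum over the interior breakpoints, listed by
    [belast b s], telescopes. *)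
Lemma pieces_telescope h a b s : pieces h a (b :: s) ->
  \sum_(t <- belast b s) (left_slope h t - right_slope h t) =
  right_slope h a - left_slope h (last b s).
Proof.
elim: s a b => [|c s IH] a b [ab [m hm] ps].
  rewrite /= big_nil (left_slopeE (left_germ_affine _ hm)).
    by rewrite (right_slopeE (right_germ_affine _ hm)) ?subrr //; lra.
  lra.
rewrite [belast _ _]/= big_cons (IH b c ps) /=.
have -> : right_slope h a = m by apply: right_slopeE; apply: right_germ_affine hm; lra.
have -> : left_slope h b = m by apply: left_slopeE; apply: left_germ_affine hm; lra.
by rewrite addrA subrK.
Qed.

Lemma pieces_bend h a b s t : pieces h a (b :: s) -> a < t < last b s ->
  t \notin belast b s -> left_slope h t = right_slope h t.
Proof.
elim: s a b => [|c s IH] a b /=; move=> [ab [m hm] ps] tab.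
  move=> _; rewrite (left_slopeE (left_germ_affine _ hm)); last lra.
  by rewrite (right_slopeE (right_germ_affine _ hm)) //; lra.
rewrite inE negb_or => /andP[tb ts]; have [tb'|bt|tb'] := ltgtP t b.
- rewrite (left_slopeE (left_germ_affine _ hm)); last lra.
  by rewrite (right_slopeE (right_germ_affine _ hm)) //; lra.
- by apply: (IH b c ps) => //; lra.
- by rewrite tb' eqxx in tb.
Qed.

Lemma pieces_belast h a b s : pieces h a (b :: s) ->
  uniq (belast b s) /\ {in belast b s, forall t, a < t < last b s}.
Proof.
elim: s a b => [|c s IH] a b //=; move=> [ab _ ps].
have [us hs] := IH b c ps; split.
  by rewrite us andbT; apply/negP => /hs; lra.
have bl : b < last c s by case: ps => bc _ /pieces_lt; apply: lt_le_trans.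
move=> t; rewrite inE => /orP[/eqP ->|/hs]; lra.
Qed.

End Germs.

(** * Piecewise linear functions and their divisors *)

Section Graph.
Variables (R : realType) (G : metric_graph R).
Implicit Types (f g : gpoint G -> R) (x : gpoint G) (v : vertex G) (e : edge G).
Implicit Types (D E P : divisor G) (A : set (gpoint G)) (t : R).

Lemma val_epoint e t : 0 < t < len e -> gpoint_val (epoint e t) = inr (e, t).
Proof. by move=> te; rewrite /epoint insubdK. Qed.

Lemma epoint_src e t : t <= 0 -> epoint e t = vpoint (src e).
Proof.
move=> t0; rewrite /epoint /insubd insubN /= ?t0 //.
by rewrite negb_and -leNgt t0.
Qed.

Lemma epoint_tgt e t : len e <= t -> epoint e t = vpoint (tgt e).
Proof.
move=> et; have t0 := lt_le_trans (len_gt0 e) et.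
rewrite /epoint /insubd insubN /= ?[t <= 0]leNgt ?t0 //.
by rewrite negb_and -!leNgt et orbT.
Qed.

Lemma gpoint_ind (Q : gpoint G -> Prop) : (forall v, Q (vpoint v)) ->
  (forall e t, 0 < t < len e -> Q (epoint e t)) -> forall x, Q x.
Proof.
move=> Qv Qe [[v|[e t]] xP]; first by rewrite (_ : GPoint xP = vpoint v) //; exact: val_inj.
rewrite (_ : GPoint xP = epoint e t); first exact: Qe.
by apply: val_inj; rewrite /= val_epoint.
Qed.

Lemma eq_vpoint v v' : (vpoint v == vpoint v') = (v == v').
Proof. by rewrite -val_eqE. Qed.

Lemma eq_epoint e t e' t' : 0 < t < len e -> 0 < t' < len e' ->
  (epoint e t == epoint e' t') = (e == e') && (t == t').
Proof. by move=> te te'; rewrite -val_eqE /= !val_epoint. Qed.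

Lemma neq_epoint_vpoint e t v : 0 < t < len e -> (epoint e t == vpoint v) = false.
Proof. by move=> te; rewrite -val_eqE /= !val_epoint. Qed.

Lemma ord_epoint f e t : 0 < t < len e ->
  ord f (epoint e t) = left_slope (f \o epoint e) t - right_slope (f \o epoint e) t.
Proof. by move=> te; rewrite /ord val_epoint. Qed.

Lemma pl_germs f :
  pl_function f <-> forall e, has_germs (f \o epoint e) (len e).
Proof. by split=> hf e; have := hf e; rewrite piecewise_affine_germs ?len_gt0. Qed.

Lemma pl_cst c : pl_function (fun _ : gpoint G => c).
Proof.
apply/pl_germs => e; split=> t _; exists 0; exists 1 => // u _ /=;
  by rewrite mul0r addr0.
Qed.

Lemma pl_sub f g : pl_function f -> pl_function g ->
  pl_function (fun x => f x - g x).
Proof.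
move=> /pl_germs hf /pl_germs hg; apply/pl_germs => e.
have [fr fl] := hf e; have [gr gl] := hg e; split=> t ht.
  by have [m hm] := fr t ht; have [n hn] := gr t ht; exists (m - n); apply: right_germB.
by have [m hm] := fl t ht; have [n hn] := gl t ht; exists (m - n); apply: left_germB.
Qed.

Lemma pl_min f c : pl_function f -> pl_function (fun x => Num.min (f x) c).
Proof.
move=> /pl_germs hf; apply/pl_germs => e; have [fr fl] := hf e; split=> t ht.
  by have [m hm] := fr t ht; apply: right_germ_min hm.
by have [m hm] := fl t ht; apply: left_germ_min hm.
Qed.

Section Slopes.
Variables f g : gpoint G -> R.
Hypotheses (fP : pl_function f) (gP : pl_function g).

Lemma pl_right_germ e t : 0 <= t < len e ->
  right_germ (f \o epoint e) t (right_slope (f \o epoint e) t).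
Proof. by move=> te; apply: right_slope_germ te; move/pl_germs: fP. Qed.

Lemma pl_left_germ e t : 0 < t <= len e ->
  left_germ (f \o epoint e) t (left_slope (f \o epoint e) t).
Proof. by move=> te; apply: left_slope_germ te; move/pl_germs: fP. Qed.

End Slopes.

Lemma ord_sub f g x : pl_function f -> pl_function g ->
  ord (fun y => f y - g y) x = ord f x - ord g x.
Proof.
move=> fP gP; have le e := len_gt0 e.
have hl e t : 0 < t <= len e -> left_slope ((fun y => f y - g y) \o epoint e) t =
    left_slope (f \o epoint e) t - left_slope (g \o epoint e) t.
  by move=> te; apply/left_slopeE/left_germB; apply: pl_left_germ.
have hr e t : 0 <= t < len e -> right_slope ((fun y => f y - g y) \o epoint e) t =
    right_slope (f \o epoint e) t - right_slope (g \o epoint e) t.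
  by move=> te; apply/right_slopeE/right_germB; apply: pl_right_germ.
elim/gpoint_ind: x => [v|e t te]; last first.
  by rewrite !ord_epoint // hl; [rewrite hr; [lia|lra]|lra].
rewrite /ord /=.
under eq_bigr do rewrite hl ?le ?lexx //.
under [X in _ - X]eq_bigr do rewrite hr ?le ?lexx //.
by rewrite !sumrB; ring.
Qed.

Lemma ord_cst c x : ord (fun=> c) x = 0.
Proof.
have hr e t : right_slope ((fun=> c) \o @epoint _ G e) t = 0.
  by apply: right_slopeE; exists 1 => // u _ /=; rewrite mul0r addr0.
have hl e t : left_slope ((fun=> c) \o @epoint _ G e) t = 0.
  by apply: left_slopeE; exists 1 => // u _ /=; rewrite mul0r addr0.
rewrite /ord; case: (gpoint_val x) => [v|[e t]]; last by rewrite hl hr.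
by rewrite !big1 // => e _; rewrite ?hl ?hr.
Qed.

Lemma slope_mono f g e t : pl_function f -> pl_function g ->
  f (epoint e t) = g (epoint e t) -> (forall y, g y <= f y) ->
  (0 < t <= len e -> left_slope (f \o epoint e) t <= left_slope (g \o epoint e) t) /\
  (0 <= t < len e -> right_slope (g \o epoint e) t <= right_slope (f \o epoint e) t).
Proof.
move=> fP gP fg gf; split=> te.
  by apply: (left_germ_le (pl_left_germ fP te) (pl_left_germ gP te)) => //; exists 1 => // u _; apply: gf.
by apply: (right_germ_le (pl_right_germ gP te) (pl_right_germ fP te)) => //; exists 1 => // u _; apply: gf.
Qed.

(** Where [f] touches [g] from above, each incoming slope of [f] is at most that of [g]. *)
Lemma ord_mono f g x : pl_function f -> pl_function g ->
  f x = g x -> (forall y, g y <= f y) -> ord f x <= ord g x.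
Proof.
move=> fP gP + gf; elim/gpoint_ind: x => [v|e t te] fg; last first.
  rewrite !ord_epoint //; have [h1 h2] := slope_mono fP gP fg gf.
  by apply: lerB; [apply: h1|apply: h2]; lra.
rewrite /ord /=; apply: lerB; apply: ler_sum => e /eqP ev.
  have fg' : f (epoint e (len e)) = g (epoint e (len e)) by rewrite !epoint_tgt ?ev.
  by apply: (slope_mono fP gP fg' gf).1; rewrite len_gt0 lexx.
have fg' : f (epoint e 0) = g (epoint e 0) by rewrite !epoint_src ?ev.
by apply: (slope_mono fP gP fg' gf).2; rewrite len_gt0 lexx.
Qed.

Lemma pl_bends f e : pl_function f -> exists s : seq R,
  [/\ uniq s, {in s, forall t, 0 < t < len e},
      forall t, 0 < t < len e -> t \notin s -> ord f (epoint e t) = 0 &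
      \sum_(t <- s) ord f (epoint e t) =
      right_slope (f \o epoint e) 0 - left_slope (f \o epoint e) (len e)].
Proof.
move=> fP; have [s ps ls] := (piecewise_affineP _ _).1 (fP e).
case: s ps ls => [|b s] ps ls; first by have := len_gt0 e; rewrite -ls ltxx.
have := pieces_telescope ps; have := @pieces_bend _ _ _ _ _ _ ps.
have [us] := pieces_belast ps; rewrite /= in ls; rewrite ls => hs hb <-.
exists (belast b s); split=> // [t te ts|]; first by rewrite ord_epoint // hb ?subrr.
by apply: eq_big_seq => t /hs te; rewrite ord_epoint.
Qed.

(** Each edge has finitely many bends, so [ord f] is a divisor. The bends inside an edge cancel
    against its end slopes, hence degree 0. *)
Lemma principal_div f : pl_function f ->
  exists2 P : divisor G, (forall x, coeff x P = ord f x) & deg P = 0.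
Proof.
move=> fP; have /choice [S HS] := fun e => pl_bends e fP.
exists (\sum_v << ord f (vpoint v) *g vpoint v >> +
        \sum_e \sum_(t <- S e) << ord f (epoint e t) *g epoint e t >>); last first.
  rewrite raddfD !raddf_sum /=.
  under eq_bigr do rewrite degU.
  under [X in _ + X]eq_bigr => e _.
    rewrite raddf_sum /=; under eq_bigr do rewrite degU.
    have [_ _ _ ->] := HS e; over.
  rewrite /ord /= !sumrB.
  have ends (p : edge G -> vertex G) (F : edge G -> int) :
    \sum_v \sum_(e | p e == v) F e = \sum_e F e.
    by rewrite [RHS](partition_big p predT).
  by rewrite !ends; ring.
move=> x; rewrite coeffD !raddf_sum /=.
elim/gpoint_ind: x => [v|e t te].
  rewrite (bigD1 v) //= coeffU eqxx mulr1 !big1 ?addr0 // => [e _|v' v'v].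
    rewrite raddf_sum big_seq big1 //= => t; have [_ hs _ _] := HS e.
    by move=> /hs te; rewrite coeffU neq_epoint_vpoint ?mulr0.
  by rewrite coeffU eq_vpoint (negbTE v'v) mulr0.
rewrite big1 => [|v _]; last by rewrite coeffU eq_sym neq_epoint_vpoint ?mulr0.
have [us hs h0 _] := HS e.
rewrite add0r (bigD1 e) //= [X in _ + X]big1 => [|e' e'e]; last first.
  rewrite raddf_sum big_seq big1 //= => t'; have [_ hs' _ _] := HS e'.
  by move=> /hs' te'; rewrite coeffU eq_epoint // (negbTE e'e) mulr0.
rewrite addr0 raddf_sum /=; have [ts|ts] := boolP (t \in S e); last first.
  rewrite h0 // big_seq big1 // => t' ts'; rewrite coeffU eq_epoint //; last exact: hs.
  by rewrite eqxx; case: eqP ts' ts => [-> ->|] // _ _ _; rewrite mulr0.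
rewrite (bigD1_seq t) //= big_seq_cond big1 => [|t' /andP[ts' t't]].
  by rewrite addr0 coeffU eqxx mulr1.
by rewrite coeffU eq_epoint ?(negbTE t't) ?andbF ?mulr0 //; apply: hs.
Qed.

End Graph.

(** * Ramps, the building blocks of explicit piecewise linear functions *)

Section Ramps.
Variable R : realType.
Implicit Types (h k : R -> R) (t l p q : R).

Definition ramp p q t : R := if t <= p then 0 else if t <= q then t - p else q - p.

Lemma right_germ_ramp p q t : p <= q -> right_germ (ramp p q) t (p <= t < q)%R.
Proof.
move=> pq; have [tp|pt] := ltP t p; rewrite ?mul0r /=.
  exists (p - t) => [|u tu]; first lra.
  by rewrite /ramp !ifT ?mul0r ?addr0; lra.
have [tq|qt] := ltP t q.
  exists (q - t) => [|u tu]; first lra.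
  by rewrite /ramp mul1r; do ?case: ifP => ?; lra.
exists 1 => // u tu.
by rewrite /ramp mul0r; do ?case: ifP => ?; lra.
Qed.

Lemma left_germ_ramp p q t : p <= q -> left_germ (ramp p q) t (p < t <= q)%R.
Proof.
move=> pq; have [tp|pt] := leP t p.
  by exists 1 => // u tu; rewrite /ramp !ifT ?mul0r ?addr0; lra.
have [tq|qt] := leP t q.
  exists (t - p) => [|u tu]; first lra.
  by rewrite /ramp mul1r; do ?case: ifP => ?; lra.
exists (t - q) => [|u tu]; first lra.
by rewrite /ramp mul0r; do ?case: ifP => ?; lra.
Qed.

Lemma eq_right_germ h k l t m : t < l -> (forall u, t <= u <= l -> k u = h u) ->
  right_germ h t m -> right_germ k t m.
Proof.
move=> tl kh [d d0 hd].
have dl : Num.min d (l - t) <= d by rewrite ge_min lexx.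
have dt : Num.min d (l - t) <= l - t by rewrite ge_min lexx orbT.
exists (Num.min d (l - t)) => [|u ut]; first by rewrite lt_min d0 subr_gt0.
rewrite !kh; [apply: hd|..]; lra.
Qed.

Lemma eq_left_germ h k l t m : l < t -> (forall u, l <= u <= t -> k u = h u) ->
  left_germ h t m -> left_germ k t m.
Proof.
move=> lt kh /germ_reflect hm; apply/germ_reflect.
by apply: (eq_right_germ (l := - l)) hm => [|u ut]; [|apply: kh]; lra.
Qed.

End Ramps.

(** * Linear equivalence and the motion of chips inside an edge *)

Section Divisors.
Variables (R : realType) (G : metric_graph R).
Implicit Types (f g : gpoint G -> R) (x : gpoint G) (v : vertex G) (e : edge G).
Implicit Types (D E P : divisor G) (A : set (gpoint G)) (t : R).

Lemma principal_deg P : principal P -> deg P = 0.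
Proof.
case=> f /principal_div [Q fQ Q0] fP; rewrite -Q0; congr deg.
by apply/eqP/freeg_eqP => x; rewrite fQ fP.
Qed.

Lemma principal0 : principal (0 : divisor G).
Proof. by exists (fun=> 0); [exact: pl_cst|move=> x; rewrite coeff0 ord_cst]. Qed.

Lemma principal_sub P Q : principal P -> principal Q -> principal (P - Q).
Proof.
case=> f fpl fP [g gpl gQ]; exists (fun x => f x - g x); first exact: pl_sub.
by move=> x; rewrite coeffB fP gQ ord_sub.
Qed.

Lemma equivalent_refl D : equivalent D D.
Proof. by rewrite /equivalent subrr; apply: principal0. Qed.

Lemma equivalent_sym D E : equivalent D E -> equivalent E D.
Proof.
by rewrite /equivalent => /(principal_sub principal0); rewrite sub0r opprB.
Qed.

Lemma equivalent_trans D E F : equivalent D E -> equivalent E F -> equivalent D F.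
Proof.
move=> DE /equivalent_sym /(principal_sub DE).
by rewrite /equivalent opprB addrA subrK.
Qed.

Lemma equivalent_deg D E : equivalent D E -> deg D = deg E.
Proof. by move=> /principal_deg/eqP; rewrite degB subr_eq0 => /eqP. Qed.

Lemma equivalent_add2r D E F : equivalent D E -> equivalent (D + F) (E + F).
Proof. by rewrite /equivalent opprD addrACA subrr addr0. Qed.

Definition winnable D : Prop := exists2 D', equivalent D' D & effective D'.

(** The witnesses on the two sides differ by [<< x >>]; the right side says that the class of [D]
    can reach [x]. *)
Lemma winnable_sub1P D x : winnable (D - << x >>) <->
  exists2 D', equivalent D' D & effective D' /\ 1 <= coeff x D'.
Proof.
split=> [[D' eD' pD']|[D' eD' [pD' xD']]].
  exists (D' + << x >>).
    by have := equivalent_add2r << x >> eD'; rewrite subrK.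
  split=> [y|]; rewrite coeffD coeffU ?eqxx ?lerDr //.
  by rewrite addr_ge0 // mul1r ler0n.
exists (D' - << x >>); first exact: equivalent_add2r.
move=> y; rewrite coeffB coeffU mul1r subr_ge0; case: eqP => [<-//|_]; exact: pD'.
Qed.

Section RampFunction.
Variables (k : vertex G -> R) (a a' b b' : edge G -> R).
Hypothesis aa' : forall e, 0 <= a e <= a' e.
Hypothesis a'l : forall e, a' e <= len e.
Hypothesis bb' : forall e, 0 <= b e <= b' e.
Hypothesis b'l : forall e, b' e <= len e.
Hypothesis kab : forall e, k (tgt e) = k (src e) + (a' e - a e) - (b' e - b e).

(* k at the vertices, slope 1 on [a e, a' e] and -1 on [b e, b' e]; where these
   intervals overlap the slopes cancel. *)
Definition ramp_function x : R := match gpoint_val x with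
  | inl v => k v
  | inr (e, t) => k (src e) + ramp (a e) (a' e) t - ramp (b e) (b' e) t
  end.

(** The formula inside the edge persists at its ends: both ramps vanish at 0, and [kab] gives the
    value at [len e]. The whole is written with differences so that [right_germB] and [left_germB]
    apply. *)
Let ramp_functionE e (t : R) : 0 <= t <= len e ->
  (ramp_function \o epoint e) t =
  (ramp (a e) (a' e) t - ramp (b e) (b' e) t) - (- k (src e)).
Proof.
rewrite opprK addrC addrA /= => t0l; have [t0|t0] := leP t 0.
  have := aa' e; have := bb' e; rewrite epoint_src // /ramp_function /ramp /= => *.
  by rewrite !ifT ?addr0 ?subr0; lra.
have [lt|tl] := leP (len e) t; last by rewrite /ramp_function val_epoint //; lra.
have := aa' e; have := bb' e; have := a'l e; have := b'l e; have := kab e.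
rewrite epoint_tgt // /ramp_function /ramp /= => *.
by do ?case: ifP => ?; lra.
Qed.

Lemma ramp_right_germ e t : 0 <= t < len e ->
  right_germ (ramp_function \o epoint e) t
    ((a e <= t < a' e)%R%:Z - (b e <= t < b' e)%R%:Z).
Proof.
move=> te; apply: (eq_right_germ (l := len e)
  (h := fun t => (ramp (a e) (a' e) t - ramp (b e) (b' e) t) - (- k (src e)))).
- lra.
- by move=> u ut; apply: ramp_functionE; lra.
rewrite -[X in right_germ _ _ X]subr0; apply: right_germB.
  by apply: right_germB; apply: right_germ_ramp; have := aa' e; have := bb' e; lra.
by exists 1 => // u _; rewrite mul0r addr0.
Qed.

Lemma ramp_left_germ e t : 0 < t <= len e ->
  left_germ (ramp_function \o epoint e) t
    ((a e < t <= a' e)%R%:Z - (b e < t <= b' e)%R%:Z).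
Proof.
move=> te; apply: (eq_left_germ (l := 0)
  (h := fun t => (ramp (a e) (a' e) t - ramp (b e) (b' e) t) - (- k (src e)))).
- lra.
- by move=> u ut; apply: ramp_functionE; lra.
rewrite -[X in left_germ _ _ X]subr0; apply: left_germB.
  by apply: left_germB; apply: left_germ_ramp; have := aa' e; have := bb' e; lra.
by exists 1 => // u _; rewrite mul0r addr0.
Qed.

Lemma ramp_pl : pl_function ramp_function.
Proof.
apply/pl_germs => e; split=> t te; eexists; first exact: ramp_right_germ.
exact: ramp_left_germ.
Qed.

Lemma ramp_ord_epoint e t : 0 < t < len e -> ord ramp_function (epoint e t) =
  ((a e < t <= a' e)%R%:Z - (b e < t <= b' e)%R%:Z) -
  ((a e <= t < a' e)%R%:Z - (b e <= t < b' e)%R%:Z) :> int.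
Proof.
move=> te; rewrite ord_epoint //.
rewrite (left_slopeE (ramp_left_germ _)); last lra.
by rewrite (right_slopeE (ramp_right_germ _)) //; lra.
Qed.

Lemma ramp_ord_vpoint v : ord ramp_function (vpoint v) =
  \sum_(e | tgt e == v) ((a e < len e <= a' e)%R%:Z - (b e < len e <= b' e)%R%:Z) -
  \sum_(e | src e == v) ((a e <= 0 < a' e)%R%:Z - (b e <= 0 < b' e)%R%:Z) :> int.
Proof.
rewrite /ord /=; congr (_ - _); apply: eq_bigr => e _.
  by rewrite (left_slopeE (ramp_left_germ _)) // len_gt0 lexx.
by rewrite (right_slopeE (ramp_right_germ _)) // len_gt0 lexx.
Qed.

End RampFunction.

Lemma sum_single (I : finType) (P : pred I) (F : I -> int) i :
  (forall j, j != i -> F j = 0) -> \sum_(j | P j) F j = if P i then F i else 0.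
Proof.
move=> F0; rewrite big_mkcond (bigD1 i) //= big1 ?addr0 // => j /F0 ->.
by rewrite if_same.
Qed.

(* Fire the complement of the open segment between a and b until one of the two
   chips reaches x. *)
Lemma fire_inside E e (a b x : R) : src e != tgt e -> effective E ->
  0 <= a < x -> x < b <= len e ->
  1 <= coeff (epoint e a) E -> 1 <= coeff (epoint e b) E ->
  winnable (E - << epoint e x >>).
Proof.
move=> st pE ax xb Ea Eb.
(* Both chips travel the distance [d], and the one nearer to [x] arrives. *)
have [d [d0 da db dx]] : exists d : R, [/\ 0 < d, d <= x - a, d <= b - x &
    d = x - a \/ d = b - x].
  by have [?|?] := leP (x - a) (b - x); [exists (x - a)|exists (b - x)]; split; lra.
(* On the other edges the two intervals shrink to the point 0, so [f] vanishes there. *)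
pose on (y : R) e' := if e' == e then y else 0.
pose k0 : vertex G -> R := fun=> 0.
pose f := ramp_function k0 (on a) (on (a + d)) (on (b - d)) (on b).
have H1 e' : 0 <= on a e' <= on (a + d) e' by rewrite /on; case: eqP => _; lra.
have H2 e' : on (a + d) e' <= len e'.
  by rewrite /on; case: eqP => [->|_]; [lra|rewrite ltW ?len_gt0].
have H3 e' : 0 <= on (b - d) e' <= on b e' by rewrite /on; case: eqP => _; lra.
have H4 e' : on b e' <= len e'.
  by rewrite /on; case: eqP => [->|_]; [lra|rewrite ltW ?len_gt0].
have H5 e' : k0 (tgt e') = k0 (src e') + (on (a + d) e' - on a e') - (on b e' - on (b - d) e').
  by rewrite /k0 /on; case: eqP => _; lra.
have [P fP _] := principal_div (ramp_pl H1 H2 H3 H4 H5).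
have EP y : coeff y (E + P) = coeff y E + ord f y by rewrite coeffD fP.
have xe : 0 < x < len e by lra.
apply/winnable_sub1P; exists (E + P).
  by rewrite /equivalent addrC addKr; exists f => //; apply: ramp_pl.
split; last first.
  rewrite EP ramp_ord_epoint // /on eqxx; have := pE (epoint e x).
  have : (b - d < x <= b) ==> (b - d <= x < b) by lra.
  have : (a <= x < a + d) ==> (a < x <= a + d) by lra.
  have : (a < x <= a + d) && ~~ (a <= x < a + d) ||
         (b - d <= x < b) && ~~ (b - d < x <= b) by lra.
  by do 4!case: (_ <= _ < _) || case: (_ < _ <= _) => //=; clear; lia.
elim/gpoint_ind => [v|e' t te']; rewrite EP.
  rewrite ramp_ord_vpoint // !(sum_single _ (i := e)) /on.
  - rewrite eqxx; have -> : (a < len e <= a + d) = false by apply/negbTE; lra.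
    have -> : (b - d < len e <= b) = (len e <= b) by apply/idP/idP; lra.
    have -> : (a <= 0 < a + d) = (a <= 0) by apply/idP/idP; lra.
    have -> : (b - d <= 0 < b) = false by apply/negbTE; lra.
    (* A vertex loses a chip only if it is the point [a] or [b], and it is not both because [e] is
       not a loop. *)
    have := pE (vpoint v); case: eqP => [tv|_]; case: eqP => [sv|_].
    + by move/eqP: st; rewrite sv tv.
    + have [lb|_] := leP (len e) b; last by clear; lia.
      by move: Eb; rewrite epoint_tgt // tv; clear; lia.
    + have [lb|_] := leP a 0; last by clear; lia.
      by move: Ea; rewrite epoint_src // sv; clear; lia.
    + by clear; lia.
  - by move=> e' /negbTE ->; rewrite ltxx !andbF.
  - by move=> e' /negbTE ->; have := len_gt0 e' => ?; rewrite [len e' <= 0]leNgt len_gt0 !andbF.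
rewrite ramp_ord_epoint // /on; case: eqP te' => [->|_] te; last first.
  have := pE (epoint e' t); have -> : (0 < t <= 0) = false by apply/negbTE; lra.
  have -> : (0 <= t < 0) = false by apply/negbTE; lra.
  by clear; lia.
have := pE (epoint e t); have [ta|ta] := eqVneq t a.
  move: Ea; rewrite -ta.
  have -> : (t < t <= t + d) = false by apply/negbTE; lra.
  have -> : (b - d < t <= b) = false by apply/negbTE; lra.
  rewrite (_ : t <= t < t + d); last lra.
  have -> : (b - d <= t < b) = false by apply/negbTE; lra.
  by clear; lia.
have [tb|tb] := eqVneq t b.
  move: Eb; rewrite -tb.
  have -> : (a < t <= a + d) = false by apply/negbTE; lra.
  rewrite (_ : t - d < t <= t); last lra.
  have -> : (a <= t < a + d) = false by apply/negbTE; lra.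
  have -> : (t - d <= t < t) = false by apply/negbTE; lra.
  by clear; lia.
have : (a <= t < a + d) ==> (a < t <= a + d) by move/eqP: ta; lra.
have : (b - d < t <= b) ==> (b - d <= t < b) by move/eqP: tb; lra.
by do 4!case: (_ && _) => //=; clear; lia.
Qed.

End Divisors.

(** * Vertices of a loopless graph determine the rank *)

Section RankDetermining.
Variables (R : realType) (G : metric_graph R).
Implicit Types (f g : gpoint G -> R) (x : gpoint G) (v : vertex G) (e : edge G).
Implicit Types (D E P : divisor G) (A : set (gpoint G)) (t : R).

(** Where [c <= f x], the constant [c] touches the truncated function from above; where [f x <= c],
    [f] does. Both bounds then follow from [ord_mono]. *)
Lemma div_min_ge f c D1 D2 : pl_function f ->
  (forall x, coeff x (D2 - D1) = ord f x) ->
  exists2 E, equivalent E D1 &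
  [/\ forall x, coeff x E = coeff x D1 + ord (fun y => Num.min (f y) c) x,
      forall x, c <= f x -> coeff x D1 <= coeff x E &
      forall x, f x <= c -> coeff x D2 <= coeff x E].
Proof.
move=> fP fD; have gP := pl_min c fP; have [P gPE _] := principal_div gP.
exists (D1 + P).
  by rewrite /equivalent addrC addKr; exists (fun y => Num.min (f y) c).
split=> x; rewrite coeffD gPE // => fx.
  rewrite lerDl -(@ord_cst _ _ c x); apply: ord_mono => //; first exact: pl_cst.
    by rewrite min_r.
  by move=> y; rewrite ge_min lexx orbT.
have -> : coeff x D2 = coeff x D1 + ord f x by rewrite -fD coeffB addrC subrK.
rewrite lerD2l; apply: ord_mono => // [|y]; first by rewrite min_l.
by rewrite ge_min lexx.
Qed.

Lemma winnable_edge D e t : src e != tgt e -> 0 < t < len e ->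
  winnable (D - << vpoint (src e) >>) -> winnable (D - << vpoint (tgt e) >>) ->
  winnable (D - << epoint e t >>).
Proof.
move=> st te /winnable_sub1P[D1 D1D [pD1 D1s]] /winnable_sub1P[D2 D2D [pD2 D2t]].
have [f fP fD] : principal (D2 - D1).
  exact: equivalent_trans D2D (equivalent_sym D1D).
set c := f (epoint e t).
have [E ED1 [Ef E1 E2]] := div_min_ge c fP fD.
have pE : effective E.
  move=> y; have [cf|fc] := leP c (f y); first exact: le_trans (E1 y cf).
  exact: le_trans (E2 y (ltW fc)).
(* Without a chip of [E], the truncation has no bend at this point, which is a maximum of it, so it
   is flat there. As [f] lies above it, the left slope of [f] is at most 0 and the right slope at
   least 0; effectivity of [D2] excludes a convex bend, so both vanish. *)
have chip u : 0 < u < len e -> f (epoint e u) = c ->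
    ~ (1 <= coeff (epoint e u) E) ->
    left_slope (f \o epoint e) u = 0 /\ right_slope (f \o epoint e) u = 0.
  move=> ue fu; have gP := pl_min c fP.
  have := E1 (epoint e u); rewrite fu lexx => /(_ isT).
  have := pD1 (epoint e u); have := pD2 (epoint e u).
  have := fD (epoint e u); rewrite coeffB Ef !ord_epoint //.
  have [||fl fr] := @slope_mono _ _ f (fun y => Num.min (f y) c) e u fP gP.
  - by rewrite fu minxx.
  - by move=> y; rewrite ge_min lexx.
  have [||cl cr] := @slope_mono _ _ (fun=> c) (fun y => Num.min (f y) c) e u (pl_cst _) gP.
  - by rewrite fu minxx.
  - by move=> y; rewrite ge_min lexx orbT.
  have ue1 : 0 < u <= len e by lra.
  have ue2 : 0 <= u < len e by lra.
  have := fl ue1; have := fr ue2; have := cl ue1; have := cr ue2.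
  have -> : right_slope ((fun=> c) \o @epoint _ G e) u = 0.
    by apply: right_slopeE; exists 1 => // y _; rewrite mul0r addr0.
  have -> : left_slope ((fun=> c) \o @epoint _ G e) u = 0.
    by apply: left_slopeE; exists 1 => // y _; rewrite mul0r addr0.
  by clear; lia.
have [s ps ls] := (piecewise_affineP _ _).1 (fP e).
(* With no chip of [E] between the source and [t], level [c] would propagate to the source, where
   [E] keeps the chip of [D1]. *)
have [a at_ Ea] : exists2 a, 0 <= a <= t & 1 <= coeff (epoint e a) E.
  apply: contrapT => noa.
  have noa' u : 0 <= u <= t -> ~ 1 <= coeff (epoint e u) E.
    by move=> ut Eu; apply: noa; exists u.
  apply: (noa' 0); first lra.
  have f0 : f (epoint e 0) = c.
    apply: (level_left ps (x := t)) => //; first by rewrite ls; lra.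
    by move=> u ut fu; apply: (chip u _ fu (noa' u _)).1; lra.
  by rewrite epoint_src // in f0 *; apply: le_trans D1s (E1 _ _); rewrite f0.
(* Symmetrically, [E] keeps the chip of [D2] at the target. *)
have [b tb Eb] : exists2 b, t <= b <= len e & 1 <= coeff (epoint e b) E.
  apply: contrapT => nob.
  have nob' u : t <= u <= len e -> ~ 1 <= coeff (epoint e u) E.
    by move=> ut Eu; apply: nob; exists u.
  apply: (nob' (len e)); first lra.
  have fl : f (epoint e (last 0 s)) = c.
    apply: (level_right ps (x := t)) => //; first by rewrite ls; lra.
    by rewrite ls => u ut fu; apply: (chip u _ fu (nob' u _)).2; lra.
  by rewrite ls epoint_tgt // in fl *; apply: le_trans D2t (E2 _ _); rewrite fl.
have ED := equivalent_trans ED1 D1D.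
have [ta|ta] := eqVneq t a.
  by apply/winnable_sub1P; exists E; rewrite // ta.
have [tb'|tb'] := eqVneq t b.
  by apply/winnable_sub1P; exists E; rewrite // tb'.
have [||E' EE' pE'] := fire_inside (x := t) st pE _ _ Ea Eb.
- by move/eqP: ta; lra.
- by move/eqP: tb'; lra.
exists E' => //; apply: equivalent_trans EE' _.
exact: equivalent_add2r.
Qed.

Lemma effective_deg0 D : effective D -> deg D = 0 -> D = 0.
Proof. by move=> /fgposP; apply: fgpos_eq0P. Qed.

Lemma effective_deg_ge0 D : effective D -> 0 <= deg D.
Proof.
move=> pD; rewrite -(freeg_sumE D) raddf_sum /= sumr_ge0 // => x _.
by rewrite degU.
Qed.

Lemma effective_degS D (n : nat) : effective D -> deg D = n.+1 ->
  exists x E, [/\ D = E + << x >>, effective E, deg E = n & 1 <= coeff x D].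
Proof.
move=> pD dD; have [x Dx] : exists x, coeff x D != 0.
  apply: contrapT => no; suff D0 : D = 0 by rewrite D0 deg0 in dD.
  apply/eqP/freeg_eqP => x; rewrite coeff0; apply/eqP; apply: contrapT => /negP Dx.
  by apply: no; exists x.
have Dx1 : 1 <= coeff x D by have := pD x; lia.
exists x, (D - << x >>); split=> //; first by rewrite subrK.
  move=> y; rewrite coeffB coeffU mul1r subr_ge0; case: eqP => [<-//|_]; exact: pD.
by rewrite degB degU dD; lia.
Qed.

Lemma rank_at_leastP A D n : rank_at_least A D n <->
  forall E, effective E -> deg E = n -> supported_in A E -> winnable (D - E).
Proof.
split=> H E pE dE sE; have [D' D'D pD'] := H E pE dE sE.
  by exists (D' - E) => //; apply: equivalent_add2r.
exists (D' + E); last by rewrite addrK.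
by have := equivalent_add2r E D'D; rewrite subrK.
Qed.

(** Induction on the degree of [E]. A chip [x] of [E] is exchanged for points of [A]: the
    hypothesis, applied to [D - F] with [F] supported in [A], reduces the removal of [F + << x >>]
    to that of [F + << y >>] with [y] in [A]. The other chips are treated with [D - << x >>] in
    place of [D]. *)
Lemma rank_at_least_full A :
  (forall D, (forall x, A x -> winnable (D - << x >>)) ->
     forall x, winnable (D - << x >>)) ->
  forall D n, rank_at_least A D n -> rank_at_least [set: gpoint G] D n.
Proof.
move=> HA D n /rank_at_leastP H; apply/rank_at_leastP => E pE dE _.
have [m nm] : exists m : nat, n = m.
  by exists `|n|%N; have := effective_deg_ge0 pE; lia.
rewrite {}nm {n} in H dE; elim: m D E H pE dE => [|m IH] D E H pE dE.
  by apply: H; rewrite // (effective_deg0 pE dE) => x; rewrite coeff0.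
have [x [E1 [-> pE1 dE1 _]]] := effective_degS pE dE.
rewrite opprD addrA [D - E1 - _]addrAC.
apply: IH => // F pF dF sF; rewrite addrAC; apply: HA => y Ay.
rewrite -addrA -opprD; apply: H.
- by move=> z; rewrite coeffD coeffU addr_ge0 // mul1r ler0n.
- by rewrite degD degU dF; lia.
move=> z; rewrite coeffD coeffU mul1r; have [<- //|_] := eqVneq y z.
by rewrite addr0; apply: sF.
Qed.

(** Testing with multiples of a point of [A] bounds the admissible degrees by [deg D], so a largest
    one exists; by [rank_at_least_full] it is also the rank. *)
Lemma rank_determining_supp A : (exists x, A x) ->
  (forall D, (forall x, A x -> winnable (D - << x >>)) ->
     forall x, winnable (D - << x >>)) ->
  rank_determining A.
Proof.
move=> [x0 Ax0] HA D; have [wD|nwD] := pselect (winnable D); last first.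
  by exists (-1); split; left.
have bound (B : set (gpoint G)) s : B x0 -> rank_at_least B D s -> s <= deg D.
  move=> Bx0 H; have [s0|s0] := leP 0 s; last first.
    apply: le_trans (ltW s0) _; have [D' D'D pD'] := wD.
    by rewrite -(equivalent_deg D'D) effective_deg_ge0.
  have [|||D' D'D pD'] := H << s *g x0 >>.
  - by move=> x; rewrite coeffU; case: eqP; rewrite ?mulr1 ?mulr0.
  - by rewrite degU.
  - by move=> x; rewrite coeffU; have [<- //|_] := eqVneq x0 x; rewrite mulr0 eqxx.
  by have := effective_deg_ge0 pD'; rewrite degB degU (equivalent_deg D'D) subr_ge0.
pose Q := fun n : nat => `[< rank_at_least A D n >].
have Q0 : exists n, Q n.
  exists 0%N; apply/asboolP/rank_at_leastP => E pE dE _.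
  by rewrite (effective_deg0 pE dE) subr0.
have Qb n : Q n -> (n <= `|deg D|)%N.
  by move=> /asboolP/(bound _ _ Ax0); lia.
case: (ex_maxnP Q0 Qb) => r /asboolP Qr rmax.
have maxA s : rank_at_least A D s -> s <= r.
  move=> Hs; case: s Hs => [n|n] Hs; last by lia.
  by rewrite lez_nat; apply: rmax; apply/asboolP.
have full := rank_at_least_full HA.
exists (r : int); split; right; split=> //; first exact: full.
move=> s Hs; apply: maxA => E pE dE _; exact: Hs.
Qed.

Lemma vertices_rank_determining : (forall e, src e != tgt e) ->
  rank_determining [set x | exists v, x = vpoint v].
Proof.
move=> loopless; apply: rank_determining_supp => [|D Dv].
  have /card_gt0P[v _] := vertex_nonempty G; exists (vpoint v); by exists v.
elim/gpoint_ind => [v|e t te]; first by apply: Dv; exists v.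
by apply: winnable_edge => //; apply: Dv; eexists.
Qed.

End RankDetermining.

(** * Dhar's algorithm and functions given by vertex heights *)

Section Vertices.
Variables (R : realType) (G : metric_graph R).
Implicit Types (x : gpoint G) (u v w : vertex G) (e : edge G).
Implicit Types (D E P : divisor G) (A B : set (gpoint G)) (t : R).
Implicit Type (Phi : vertex G -> edge G -> int).

(** Sum over the edge ends at [v] of a weight of the far vertex and the edge. Burning counts and
    divisors of height functions both have this form. *)
Definition star Phi v : int :=
  \sum_(e | tgt e == v) Phi (src e) e + \sum_(e | src e == v) Phi (tgt e) e.

Lemma star_ge0 Phi v : (forall w e, 0 <= Phi w e) -> 0 <= star Phi v.
Proof. by move=> Phi0; rewrite addr_ge0 // sumr_ge0. Qed.

Lemma star_eq0 Phi e : (forall w e, 0 <= Phi w e) -> star Phi (tgt e) = 0 ->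
  Phi (src e) e = 0.
Proof.
move=> Phi0 /eqP; rewrite /star paddr_eq0 ?sumr_ge0 // => /andP[/eqP + _].
by move=> /psumr_eq0P; apply.
Qed.

(** The rank of [D] is 0, whereas a [B]-rank, if it exists, is at least 1. *)
Lemma not_rank_determining D x B : effective D ->
  (forall y, B y -> winnable (D - << y >>)) -> ~ winnable (D - << x >>) ->
  ~ rank_determining B.
Proof.
move=> pD DB Dx /(_ D)[r [rB rG]].
have wD : exists2 D', equivalent D' D & effective D'.
  by exists D => //; apply: equivalent_refl.
case: rB => [[]//|[_ _ rmax]]; case: rG => [[]//|[_ rG _]].
have r1 : 1 <= r.
  apply: rmax; apply/rank_at_leastP => E pE dE sE.
  have [y [E' [EE' pE' dE' Ey]]] := effective_degS pE dE.
  rewrite EE' (effective_deg0 pE' dE') add0r; apply: DB; apply: sE.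
  by apply/eqP; lia.
(* The common value [r] might exceed 1, so the test divisor puts [r] chips on [x]. *)
apply: Dx; apply/winnable_sub1P.
have [||//|D' D'D pD'] := rG << r *g x >>.
- by move=> y; rewrite coeffU; case: eqP; rewrite ?mulr1 ?mulr0; lia.
- by rewrite degU.
have cD' y : r * (x == y)%:R <= coeff y D'.
  by have := pD' y; rewrite coeffB subr_ge0 coeffU.
exists D' => //; split=> [y|]; last first.
  by apply: le_trans r1 _; have := cD' x; rewrite eqxx mulr1.
by apply: le_trans (cD' y); case: eqP => _; rewrite ?mulr1 ?mulr0 //; lia.
Qed.

(* Dhar's burning argument: if D' = D + div f is effective then f is concave on
   the edges, and every edge leaving the set M of vertices where f is minimal
   costs its end vertex in M a chip. *)
Lemma dhar D v : (forall e t, 0 < t < len e -> coeff (epoint e t) D <= 0) ->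
  coeff (vpoint v) D <= 0 ->
  (forall M : {set vertex G}, M != finset.set0 -> v \notin M ->
     exists2 u, u \in M & coeff (vpoint u) D < star (fun w _ => w \notin M) u) ->
  ~ winnable (D - << vpoint v >>).
Proof.
move=> De Dv burn /winnable_sub1P[D' [f fP fD] [pD' D'v]].
have {}fD x : coeff x D' = coeff x D + ord f x by rewrite -fD coeffB addrC subrK.
pose M := [set u | [forall w, f (vpoint u) <= f (vpoint w)]]%SET.
have Mle u w : u \in M -> f (vpoint u) <= f (vpoint w).
  by rewrite inE => /forallP.
have Mlt u w : u \in M -> w \notin M -> f (vpoint u) < f (vpoint w).
  move=> uM; rewrite ltNge; apply: contra => wu; rewrite inE; apply/forallP => z.
  exact: le_trans wu (Mle _ _ uM).
(* [D] has no positive coefficient inside edges, so effectivity of [D'] makes [f] concave there. *)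
have slopes e : [/\ (left_slope (f \o epoint e) (len e))%:~R * len e <=
      f (vpoint (tgt e)) - f (vpoint (src e)) &
    f (vpoint (tgt e)) - f (vpoint (src e)) <=
      (right_slope (f \o epoint e) 0)%:~R * len e].
  have [s ps ls] := (piecewise_affineP _ _).1 (fP e).
  case: s ps ls => [|b s] ps ls; first by have := len_gt0 e; rewrite -ls ltxx.
  have [|_] := concave_slopes ps.
    rewrite [last b s]ls => t te; rewrite -subr_ge0 -ord_epoint //.
    have := pD' (epoint e t); rewrite fD; have := De e t te; clear; lia.
  by rewrite [last b s]ls subr0 /= epoint_tgt // epoint_src.
(* Slopes are integers, so an edge from [u] to a vertex outside [M] contributes at most -1, and any
   other at most 0. *)
have ordM u : u \in M -> ord f (vpoint u) <= - star (fun w _ => w \notin M) u.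
  move=> uM; rewrite /star opprD; apply: lerB.
    rewrite -sumrN; apply: ler_sum => e /eqP eu.
    have [+ _] := slopes e; rewrite eu; case: (boolP (src e \in M)) => sM h /=.
      rewrite oppr0 -(lerz0 R) -(pmulr_lle0 _ (len_gt0 e)).
      by apply: le_trans h _; rewrite subr_le0 Mle.
    suff : left_slope (f \o epoint e) (len e) < 0 by clear; lia.
    rewrite -(ltrz0 R) -(pmulr_llt0 _ (len_gt0 e)).
    by apply: le_lt_trans h _; rewrite subr_lt0 Mlt.
  apply: ler_sum => e /eqP eu.
  have [_] := slopes e; rewrite eu; case: (boolP (tgt e \in M)) => sM h /=.
    rewrite -(ler0z R) -(pmulr_lge0 _ (len_gt0 e)).
    by apply: le_trans h; rewrite subr_ge0 Mle.
  suff : 0 < right_slope (f \o epoint e) 0 by clear; lia.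
  rewrite -(ltr0z R) -(pmulr_lgt0 _ (len_gt0 e)).
  by apply: lt_le_trans h; rewrite subr_gt0 Mlt.
(* If [f] were minimal at [v], then [ord f] would be at most 0 there, leaving no chip for [D']. *)
have [vM|vM] := boolP (v \in M).
  have := star_ge0 v (fun w _ => isT : 0 <= (w \notin M)%:Z :> int).
  by have := ordM v vM; move: D'v Dv; rewrite fD; clear; lia.
have [|u uM uD] := burn M _ vM.
  apply/set0Pn; have [u _ umin] := @arg_minP _ _ _ v xpredT (fun u => f (vpoint u)) isT.
  by exists u; rewrite inE; apply/forallP => w; apply: umin.
by have := ordM u uM; have := pD' (vpoint u); move: uD; rewrite fD; clear; lia.
Qed.

(* In the function of height_div below, an edge of length l from a vertex of
   height p to one of height q contributes climb p q l to the divisor at the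
   former. *)
Definition climb (p q l : R) : int := (p - q == l)%R%:Z - (p < q)%R%:Z.

(* Each edge is filled in by climbing at slope 1 from the lower to the higher
   end and then staying constant. *)
Lemma height_div (h : vertex G -> R) :
  (forall e, `|h (tgt e) - h (src e)| <= len e) ->
  exists P, [/\ principal P, forall e t, 0 < t < len e -> 0 <= coeff (epoint e t) P &
    forall v, coeff (vpoint v) P = star (fun w e => climb (h v) (h w) (len e)) v].
Proof.
move=> hl.
(* [up e] is the length climbed from the source, [dn e] the one climbed from the target; one of them
   is 0. *)
pose up e := Num.max 0 (h (tgt e) - h (src e)).
pose dn e := Num.max 0 (h (src e) - h (tgt e)).
have updn e : [/\ 0 <= up e <= len e, 0 <= dn e <= len e,
    up e - dn e = h (tgt e) - h (src e) & up e = 0 \/ dn e = 0].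
  move: (hl e) (len_gt0 e); rewrite ler_norml /up /dn => he l0.
  have [] := leP (h (tgt e)) (h (src e)) => hh.
    by rewrite max_l ?max_r; [split|..]; lra.
  by rewrite max_r ?max_l; [split|..]; lra.
pose low : edge G -> R := fun=> 0.
have H1 e : 0 <= low e <= up e by rewrite /low; have [] := updn e; lra.
have H2 e : up e <= len e by case: (updn e) => /andP[].
have H3 e : 0 <= len e - dn e <= len e by have [] := updn e; lra.
have H4 e : len e <= len e := lexx _.
have H5 e : h (tgt e) = h (src e) + (up e - low e) - (len e - (len e - dn e)).
  by rewrite /low; have [] := updn e; lra.
have fP := ramp_pl H1 H2 H3 H4 H5.
have [P PE _] := principal_div fP; exists P; split; first by eexists; [exact: fP|].
  move=> e t te; rewrite PE ramp_ord_epoint //.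
  have : (0 <= t < up e) ==> (0 < t <= up e) by lra.
  have : (len e - dn e < t <= len e) ==> (len e - dn e <= t < len e) by lra.
  by do 4!case: (_ && _) => //=; clear; lia.
move=> v; rewrite PE ramp_ord_vpoint // /star /low -sumrN; congr (_ + _).
  apply: eq_bigr => e /eqP ev; rewrite /climb -ev; congr (_%:Z - _%:Z).
    by congr nat_of_bool; apply/idP/eqP; have [] := updn e; have := len_gt0 e; lra.
  by congr nat_of_bool; apply/idP/idP; have [] := updn e; have := len_gt0 e; lra.
apply: eq_bigr => e /eqP ev; rewrite /climb -ev opprB; congr (_%:Z - _%:Z).
  by congr nat_of_bool; apply/idP/eqP; have [] := updn e; have := len_gt0 e; lra.
by congr nat_of_bool; apply/idP/idP; have [] := updn e; have := len_gt0 e; lra.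
Qed.

End Vertices.

Section Climb.
Variable R : realType.
Implicit Types p q l : R.

Lemma climb_ge0 p q l : q <= p -> 0 <= climb p q l.
Proof. by rewrite /climb leNgt => /negbTE ->; rewrite subr0. Qed.

Lemma climb_geN1 p q l : -1 <= climb p q l.
Proof. by rewrite /climb; case: (_ == _); case: (_ < _). Qed.

Lemma climb_eq1 p q l : 0 < l -> p - q = l -> climb p q l = 1.
Proof. by rewrite /climb => l0 pq; rewrite pq eqxx ltNge (_ : q <= p) //; lra. Qed.

End Climb.

(** * Cyclic chains of single and double edges *)

Section Cyclic.
Variables (R : realType) (G : metric_graph R) (k : nat).
Implicit Types (u v w : vertex G) (e : edge G).
Variables (y : nat -> vertex G) (a b c : nat -> edge G) (idx : vertex G -> nat).
Hypothesis k_gt1 : (1 < k)%N.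
Hypothesis idx_lt : forall u, (idx u < k.*2)%N.
Hypothesis idxK : cancel idx y.
Hypothesis yK : forall i, (i < k.*2)%N -> idx (y i) = i.
Hypothesis y_per : forall i, y (k.*2 + i) = y i.
(** The two star identities encode adjacency: [a m] and [b m] join [y m.*2] to [y m.*2.+1], and
    [c m] joins [y m.*2.+1] to [y m.*2.+2]. The vertex [y 0] is covered as [y k.*2]. *)
Hypothesis star_odd : forall Phi m, star Phi (y m.*2.+1) =
  Phi (y m.*2) (a m) + Phi (y m.*2) (b m) + Phi (y m.*2.+2) (c m).
Hypothesis star_even : forall Phi m, star Phi (y m.*2.+2) =
  Phi (y m.*2.+3) (a m.+1) + Phi (y m.*2.+3) (b m.+1) + Phi (y m.*2.+1) (c m).

Definition chips (i : nat) : int := (odd i)%:Z + (i == k.*2.-1)%:Z.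

Definition cyclic_divisor : divisor G := \sum_u << chips (idx u) *g vpoint u >>.

Lemma coeff_cyclic_vpoint u : coeff (vpoint u) cyclic_divisor = chips (idx u).
Proof.
rewrite raddf_sum /= (bigD1 u) //= coeffU eqxx mulr1 big1 ?addr0 // => v vu.
by rewrite coeffU eq_vpoint (negbTE vu) mulr0.
Qed.

Lemma coeff_cyclic_epoint e (t : R) : 0 < t < len e ->
  coeff (epoint e t) cyclic_divisor = 0.
Proof.
move=> te; rewrite raddf_sum /= big1 // => v _.
by rewrite coeffU eq_sym neq_epoint_vpoint // mulr0.
Qed.

Lemma chips_ge0 i : 0 <= chips i.
Proof. by []. Qed.

Lemma effective_cyclic : effective cyclic_divisor.
Proof.
elim/gpoint_ind => [u|e t te]; first by rewrite coeff_cyclic_vpoint chips_ge0.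
by rewrite coeff_cyclic_epoint.
Qed.

Variant parity_spec : nat -> Prop :=
  | ParityOdd m : (m < k)%N -> parity_spec m.*2.+1
  | ParityEven m : (m.+1 < k)%N -> parity_spec m.*2.+2
  | ParityZero : parity_spec 0.

Lemma parityP i : (i < k.*2)%N -> parity_spec i.
Proof.
case: i => [|i] ik; first exact: ParityZero.
rewrite -(odd_double_half i); case: (odd i) (odd_double_half i) => /= hi.
  by rewrite add1n; apply: ParityEven; lia.
by rewrite add0n; apply: ParityOdd; lia.
Qed.

(** Take the vertex of least index in [M]. If the index is odd, two edges from its predecessor leave
    [M] against one chip; at the last vertex a third edge, to [y 0], outweighs the second chip. If
    it is even, one edge leaves against no chip. *)
Lemma cyclic_dhar : ~ winnable (cyclic_divisor - << vpoint (y 0) >>).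
Proof.
apply: dhar => [e t te||M]; first by rewrite coeff_cyclic_epoint.
  by rewrite coeff_cyclic_vpoint yK /chips //=; lia.
move=> /set0Pn[v0 v0M] y0M.
have [v vM vmin] := @arg_minnP _ v0 (fun u => u \in M) idx v0M.
have out i : (i < idx v)%N -> y i \notin M.
  move=> iv; apply/negP => /vmin; rewrite yK; last exact: ltn_trans (idx_lt v).
  by rewrite leqNgt iv.
exists v => //; rewrite coeff_cyclic_vpoint.
have := idxK v; case: (idx v) / (parityP (idx_lt v)) out => [m mk|m mk|] out yv.
- rewrite -yv star_odd out // /chips /= odd_double /=.
  have [mk1|_] := eqVneq m.*2.+1 k.*2.-1; last by case: (y _ \notin M).
  rewrite (_ : m.*2.+2 = k.*2 + 0)%N; last by lia.
  by rewrite y_per y0M.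
- rewrite -yv star_even [y m.*2.+1 \in M](negbTE (out _ _)) // /chips /= odd_double /=.
  have -> : (m.*2.+2 == k.*2.-1) = false by apply/negP; lia.
  by case: (y _ \notin M).
by rewrite yv vM in y0M.
Qed.

Section Heights.
Variable j : nat.
Hypothesis jk : (j.+1 < k)%N.

(* The heights of the function that brings a chip to y_(2j+2): the distance to
   y_(2k-1) along the shorter edges, truncated as soon as one of the two fronts
   reaches y_(2j+2). *)
Definition gap (i : nat) : R :=
  if odd i then len (c i./2) else Num.min (len (a i./2)) (len (b i./2)).

Definition dist (i : nat) : R := \sum_(i <= p < k.*2.-1) gap p.

Definition cap : R := Num.min (dist j.*2.+2) (len (c j)).

Definition height (i : nat) : R :=
  if (i < j.*2.+2)%N then 0 else Num.min (dist i) cap.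

Lemma gap_gt0 i : 0 < gap i.
Proof. by rewrite /gap; case: odd; rewrite ?lt_min !len_gt0. Qed.

Lemma dist_ge0 i : 0 <= dist i.
Proof. by rewrite sumr_ge0 // => p _; rewrite ltW ?gap_gt0. Qed.

Lemma dist_far i : (k.*2.-1 <= i)%N -> dist i = 0.
Proof. by move=> ki; rewrite /dist big_geq. Qed.

Lemma distS i : (i < k.*2.-1)%N -> dist i = gap i + dist i.+1.
Proof. by move=> ik; rewrite /dist big_ltn. Qed.

Lemma dist_step i : dist i.+1 <= dist i <= gap i + dist i.+1.
Proof.
have [ik|ki] := ltnP i k.*2.-1; first by rewrite (distS ik) lexx lerDr ltW ?gap_gt0.
by rewrite !dist_far ?addr0 ?lexx ?ltW ?gap_gt0 // leqW.
Qed.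

Lemma cap_gt0 : 0 < cap.
Proof.
rewrite lt_min len_gt0 andbT distS; last by lia.
by rewrite ltr_wpDr ?dist_ge0 ?gap_gt0.
Qed.

Lemma height_ge0 i : 0 <= height i <= cap.
Proof.
rewrite /height; case: ifP => _; first by rewrite lexx ltW ?cap_gt0.
by rewrite le_min dist_ge0 ltW ?cap_gt0 //= ge_min lexx orbT.
Qed.

Lemma height_low i : (i < j.*2.+2)%N -> height i = 0.
Proof. by rewrite /height => ->. Qed.

Lemma height_high i : (j.*2.+2 <= i)%N -> height i = Num.min (dist i) cap.
Proof. by move=> ji; rewrite /height ifN // -leqNgt. Qed.

Lemma height_top : height j.*2.+2 = cap.
Proof. by rewrite /height ltnn min_r // ge_min lexx. Qed.

Lemma height_anti i : (j.*2.+2 <= i)%N -> height i.+1 <= height i.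
Proof.
move=> ji; rewrite !height_high ?(leqW ji) //.
have := dist_step i; have [] := leP (dist i) cap; have [] := leP (dist i.+1) cap; lra.
Qed.

(** The only rise, from 0 to [cap], is across [c j], whose length bounds [cap]; elsewhere truncation
    does not enlarge the differences of [dist]. *)
Lemma height_step i : `|height i - height i.+1| <= gap i.
Proof.
have g0 := gap_gt0 i; rewrite ler_norml; have [ij|ji|ij] := ltngtP i j.*2.+1.
- rewrite !height_low //; lra || lia.
- rewrite !height_high ?(leqW ji) //.
  have := dist_step i; have [] := leP (dist i) cap; have [] := leP (dist i.+1) cap; lra.
rewrite ij height_low // height_top.
have : cap <= gap j.*2.+1 by rewrite /gap /= odd_double /= uphalf_double ge_min lexx orbT.
have := cap_gt0; rewrite -ij; lra.
Qed.

Lemma height_gap i : (j.*2.+2 <= i < k.*2.-1)%N ->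
  height i = cap \/ height i - height i.+1 = gap i.
Proof.
move=> /andP[ji ik]; rewrite !height_high ?(leqW ji) //.
have := distS ik; have := gap_gt0 i.
have [] := leP (dist i) cap; have [] := leP (dist i.+1) cap; lra.
Qed.

Let h u := height (idx u).

(** The indices [k.*2] and [k.*2.+1] wrap to [y 0] and [y 1], of height 0; [height] also vanishes
    there because [dist] is an empty sum. *)
Lemma height_y i : (i <= k.*2.+1)%N -> h (y i) = height i.
Proof.
move=> ik; rewrite /h; have [ik'|ki] := ltnP i k.*2; first by rewrite yK.
rewrite -(subnKC ki) y_per yK; last by lia.
rewrite height_low; last by lia.
rewrite height_high; last by lia.
by rewrite dist_far ?min_l ?ltW ?cap_gt0 //; lia.
Qed.

Lemma gap_odd m : gap m.*2.+1 = len (c m).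
Proof. by rewrite /gap /= odd_double /= uphalf_double. Qed.

Lemma gap_even m : gap m.*2 = Num.min (len (a m)) (len (b m)).
Proof. by rewrite /gap odd_double doubleK. Qed.

(** Writing [y 0] as [y k.*2] makes one of the star identities apply to every vertex. *)
Lemma vertex_cases u : (exists2 m, (m < k)%N & u = y m.*2.+1) \/
  (exists2 m, (m < k)%N & u = y m.*2.+2).
Proof.
rewrite -(idxK u); case: (idx u) / (parityP (idx_lt u)) => [m mk|m mk|].
- by left; exists m.
- by right; exists m => //; lia.
right; exists k.-1; first by lia.
by rewrite -[LHS]y_per; congr y; lia.
Qed.

Lemma height_len e : `|h (tgt e) - h (src e)| <= len e.
Proof.
(* Indicator of a violated bound. Its star at the target of [e] vanishes, and as the weights are
   nonnegative so does the term of [e]; this avoids listing the edges. *)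
pose Phi v w e : int := (len e < `|h v - h w|)%R%:Z.
have gapE m : gap m.*2 <= len (a m) /\ gap m.*2 <= len (b m).
  by rewrite gap_even; split; rewrite ge_min lexx ?orbT.
have Phi0 v w e' : `|h v - h w| <= len e' -> Phi v w e' = 0.
  by rewrite /Phi ltNge => ->.
have step i : (i < k.*2.+1)%N -> `|h (y i) - h (y i.+1)| <= gap i.
  by move=> ik; rewrite !height_y ?height_step // ltnW.
have step' i : (i < k.*2.+1)%N -> `|h (y i.+1) - h (y i)| <= gap i.
  by rewrite distrC; apply: step.
suff : Phi (tgt e) (src e) e = 0 by rewrite /Phi; case: ltP.
apply: (@star_eq0 _ _ (Phi (tgt e))) => //.
have [[m mk ->]|[m mk ->]] := vertex_cases (tgt e).
  have mk2 : (m.*2.+1 < k.*2.+1)%N by lia.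
  have := step _ mk2; have := step' _ (ltnW mk2); have [] := gapE m.
  by rewrite gap_odd star_odd => g1 g2 g3 g4; rewrite !Phi0 ?addr0 ?(le_trans g3).
have mk2 : (m.*2.+2 < k.*2.+1)%N by lia.
have := step _ mk2; have := step' _ (ltnW mk2); have [] := gapE m.+1.
by rewrite gap_odd star_even doubleS => g1 g2 g3 g4; rewrite !Phi0 ?addr0 ?(le_trans g4).
Qed.

(** The shorter of the two parallel edges is climbed over its full length and contributes 1. *)
Lemma climb_short v w m : h v - h w = gap m.*2 -> h w <= h v ->
  1 <= climb (h v) (h w) (len (a m)) + climb (h v) (h w) (len (b m)).
Proof.
move=> vw wv; have := climb_ge0 (len (a m)) wv; have := climb_ge0 (len (b m)) wv.
move: vw; rewrite gap_even; have [_|_] := leP (len (a m)) (len (b m)).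
  by move=> /(climb_eq1 (len_gt0 _)) -> cb _; rewrite lerDl.
by move=> /(climb_eq1 (len_gt0 _)) -> _ ca; rewrite lerDr.
Qed.

(** Adding the divisor of the height function leaves no debt: rising edges are paid for by chips
    already at their lower end or arriving there from the other side. *)
Lemma height_winnable :
  winnable (cyclic_divisor - << vpoint (y j.*2.+2) >>).
Proof.
have [P [pP Pe Pv]] := height_div height_len.
apply/winnable_sub1P; exists (cyclic_divisor + P).
  by rewrite /equivalent addrC addKr.
have cN1 p q l := @climb_geN1 R p q l.
have top i : height i <= cap by case/andP: (height_ge0 i).
have top_star : 1 <= star (fun w e => climb (h (y j.*2.+2)) (h w) (len e)) (y j.*2.+2).
  rewrite star_even !height_y; try lia; rewrite height_top [height j.*2.+1]height_low //.
  have ca := climb_ge0 (len (a j.+1)) (top j.*2.+3).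
  have cb := climb_ge0 (len (b j.+1)) (top j.*2.+3).
  have cc := climb_ge0 (len (c j)) (ltW cap_gt0).
  (* The front that determines [cap] arrives: through [c j] if that edge is shorter than the
     distance, otherwise through the shorter of [a j.+1] and [b j.+1]. *)
  have [dc|cd] := leP (dist j.*2.+2) (len (c j)); last first.
    rewrite (@climb_eq1 _ cap 0) ?len_gt0 //; first by rewrite lerDr addr_ge0.
    by rewrite subr0 /cap min_r // ltW.
  have capE : cap = dist j.*2.+2 by rewrite /cap min_l.
  suff : 1 <= climb cap (height j.*2.+3) (len (a j.+1)) +
              climb cap (height j.*2.+3) (len (b j.+1)).
    by move=> /le_trans -> //; rewrite lerDl.
  have := @climb_short (y j.*2.+2) (y j.*2.+3) j.+1.
  rewrite !height_y; try lia; rewrite height_top; apply; last exact: top.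
  rewrite height_high // capE distS; last by lia.
  by rewrite doubleS min_l ?addrK // lerDr ltW ?gap_gt0.
split; last first.
  rewrite coeffD Pv; move: top_star (effective_cyclic (vpoint (y j.*2.+2))).
  by clear; lia.
elim/gpoint_ind => [u|e t te]; rewrite coeffD; last first.
  by rewrite addr_ge0 ?effective_cyclic ?Pe.
rewrite Pv; have [[m mk ->]|[m mk ->]] := vertex_cases u.
  rewrite coeff_cyclic_vpoint yK; last by lia.
  rewrite star_odd !height_y; try lia.
  have ch : 1 <= chips m.*2.+1 by rewrite /chips /= odd_double.
  (* For [m <= j] the edges [a m] and [b m] are flat, and only [c m] can rise, at the cost of one
     chip. *)
  have [mj|jm] := leqP m j.
    have h0 i : 0 <= height i by case/andP: (height_ge0 i).
    rewrite [height m.*2]height_low ?[height m.*2.+1]height_low; try lia.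
    have := climb_ge0 (len (a m)) (lexx (0 : R)).
    have := climb_ge0 (len (b m)) (lexx (0 : R)).
    move: (cN1 0 (height m.*2.+2) (len (c m))) ch.
    by do ?[move: (climb _ _ _) => ?]; clear; lia.
  have cc := climb_ge0 (len (c m)) (height_anti (_ : j.*2.+2 <= m.*2.+1)%N).
  have {}cc : 0 <= climb (height m.*2.+1) (height m.*2.+2) (len (c m)).
    by apply: cc; lia.
  (* At the last vertex the two chips pay for [a m] and [b m]. *)
  have [mk1|mk1] := eqVneq m.*2.+1 k.*2.-1.
    have {}ch : chips m.*2.+1 = 2 by rewrite /chips mk1 eqxx -mk1 /= odd_double.
    move: (cN1 (height m.*2.+1) (height m.*2) (len (a m))) cc.
    move: (cN1 (height m.*2.+1) (height m.*2) (len (b m))) ch.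
    by do ?[move: (climb _ _ _) => ?]; clear; lia.
  (* On the plateau no edge rises; off it, the chip arriving along [c m] and the one already there
     pay for [a m] and [b m]. *)
  have [|hc|hg] := @height_gap m.*2.+1; first by lia.
    move: (climb_ge0 (len (a m)) (top m.*2)) (climb_ge0 (len (b m)) (top m.*2)).
    rewrite -hc; move: cc ch.
    by do ?[move: (climb _ _ _) => ?]; clear; lia.
  rewrite gap_odd in hg; rewrite (climb_eq1 (len_gt0 _) hg).
  move: (cN1 (height m.*2.+1) (height m.*2) (len (a m))) ch.
  move: (cN1 (height m.*2.+1) (height m.*2) (len (b m))).
  by do ?[move: (climb _ _ _) => ?]; clear; lia.
have [mj|jm|mj] := ltngtP m j; last first.
- rewrite mj; apply: addr_ge0; first exact: effective_cyclic.
  exact: le_trans ler01 top_star.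
- apply: addr_ge0; first exact: effective_cyclic.
  rewrite star_even !height_y; try lia.
  have ab : height m.*2.+3 <= height m.*2.+2 by apply: height_anti; lia.
  have ca := climb_ge0 (len (a m.+1)) ab.
  have cb := climb_ge0 (len (b m.+1)) ab.
  have [mk1|mk1] := eqVneq m.+1 k.
    apply: addr_ge0; first exact: addr_ge0; apply: climb_ge0.
    rewrite !height_high; [rewrite !dist_far //|..]; lia.
  (* Off the plateau, a chip arriving along the shorter of the parallel edges pays for [c m]. *)
  have [|hc|hg] := @height_gap m.*2.+2; first by lia.
    by apply: addr_ge0; [exact: addr_ge0|rewrite hc climb_ge0].
  have := @climb_short (y m.*2.+2) (y m.*2.+3) m.+1.
  rewrite !height_y; try lia; rewrite doubleS => /(_ hg ab).
  move: (cN1 (height m.*2.+2) (height m.*2.+1) (len (c m))).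
  by do ?[move: (climb _ _ _) => ?]; clear; lia.
apply: addr_ge0; first exact: effective_cyclic.
rewrite star_even !height_y; try lia.
rewrite !height_low; try lia.
by apply: addr_ge0; first apply: addr_ge0; apply: climb_ge0.
Qed.

End Heights.

(** Odd vertices already carry a chip, and [height_winnable] reaches every even one other than
    [y 0]. *)
Lemma cyclic_not_rank_determining (B : set (gpoint G)) :
  (forall x, B x -> exists2 u, x = vpoint u & u <> y 0) -> ~ rank_determining B.
Proof.
move=> By; apply: (not_rank_determining effective_cyclic _ cyclic_dhar).
move=> _ /By[u -> uy]; move: uy; rewrite -(idxK u).
case: (idx u) / (parityP (idx_lt u)) => [m mk _|m mk _|//]; last exact: height_winnable.
apply/winnable_sub1P; exists cyclic_divisor; first exact: equivalent_refl.
split; first exact: effective_cyclic.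
rewrite coeff_cyclic_vpoint yK; last by lia.
by rewrite /chips /= odd_double.
Qed.

End Cyclic.

(** * Loops of loops *)

Section LoopOfLoops.
Variables (R : realType) (n : nat).
Let g := n.+3.
Variables (hg : (3 <= g)%N) (l : lol_edge g -> R) (l_gt0 : forall e, 0 < l e).
Let G : metric_graph R := loop_of_loops hg l_gt0.
Implicit Types (i j : 'I_n.+2) (m : nat).

Let V i : vertex G := inl i.
Let W i : vertex G := inr i.
Let vw i : edge G := inl i.
Let wv b i : edge G := inr (i, b).

(** The index type is the ring of integers modulo [n.+2], which turns the cyclic bookkeeping into
    ring identities. *)
Lemma ordS_Zp i : ordS i = i + 1.
Proof. by apply: val_inj; rewrite /= modnDmr addn1. Qed.

Lemma Zp_subKr i j : i - (i - j) = j.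
Proof. by rewrite opprB addrC subrK. Qed.

Lemma Zp_addrKl i j : i + j - i = j.
Proof. by rewrite addrAC subrr add0r. Qed.

Lemma wv_neq i : wv false i != wv true i.
Proof. by apply/eqP => -[]. Qed.

Lemma star_V Phi i : star Phi (V i) =
  Phi (W (i - 1)) (wv true (i - 1)) + Phi (W (i - 1)) (wv false (i - 1)) +
  Phi (W i) (vw i).
Proof.
rewrite /star; congr (_ + _).
  rewrite (bigD1 (wv true (i - 1))) /=; last by rewrite ordS_Zp subrK eqxx.
  rewrite (bigD1 (wv false (i - 1))) /=; last by rewrite ordS_Zp subrK eqxx wv_neq.
  rewrite big1 ?addr0 ?addrA // => -[j|[j b]] //=; rewrite ordS_Zp.
  case/andP=> /andP[/eqP[<-]]; rewrite addrK.
  by case: b; rewrite ?eqxx.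
by rewrite (big_pred1 (vw i)) // => -[j|[j b]].
Qed.

Lemma star_W Phi i : star Phi (W i) =
  Phi (V (i + 1)) (wv true i) + Phi (V (i + 1)) (wv false i) + Phi (V i) (vw i).
Proof.
rewrite /star addrC; congr (_ + _); last by rewrite (big_pred1 (vw i)) // => -[j|[j b]].
rewrite (bigD1 (wv true i)) //= (bigD1 (wv false i)) ?eqxx ?wv_neq //= ordS_Zp.
rewrite big1 ?addr0 // => -[j|[j b]] //= /andP[/andP[/eqP[->]]].
by case: b; rewrite ?eqxx.
Qed.

Lemma Zp_period m : (n.+2 + m)%:R = m%:R :> 'I_n.+2.
Proof. by rewrite natrD -[n.+2%:R]/(n.+2%:R : 'Z_n.+2) pchar_Zp // add0r. Qed.

Lemma val_natr_Zp m : (m < n.+2)%N -> (m%:R : 'I_n.+2) = m :> nat.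
Proof. by move=> mn; rewrite (@val_Zp_nat n.+2) // modn_small. Qed.

Lemma natr_val_Zp i : (i : nat)%:R = i.
Proof. exact: natr_Zp. Qed.

(** The numbering runs against the cyclic order, because the double edge at $v_i$ leads to
    $w_{i-1}$. *)
Lemma removed_V i0 (B : set (gpoint G)) :
  (forall x, B x -> exists2 u, x = vpoint u & u <> V i0) -> ~ rank_determining B.
Proof.
move=> HB; pose y m := if odd m then W (i0 - m./2.+1%:R) else V (i0 - m./2%:R).
have yE m : y m.*2 = V (i0 - m%:R) by rewrite /y odd_double doubleK.
have yO m : y m.*2.+1 = W (i0 - m.+1%:R).
  by rewrite /y /= odd_double /= uphalf_double.
pose idx (u : vertex G) : nat := match u with
  | inl j => (nat_of_ord (i0 - j)%R).*2 | inr j => (nat_of_ord (i0 - j - 1)%R).*2.+1 end.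
have idxV j : idx (V j) = (nat_of_ord (i0 - j)).*2 by [].
have idxW j : idx (W j) = (nat_of_ord (i0 - j - 1)).*2.+1 by [].
apply: (@cyclic_not_rank_determining R G n.+2 y
  (fun m => wv true (i0 - m.+1%:R)) (fun m => wv false (i0 - m.+1%:R))
  (fun m => vw (i0 - m.+1%:R)) idx) => //.
- by case=> j; rewrite /idx; have := ltn_ord (i0 - j); have := ltn_ord (i0 - j - 1); lia.
- case=> j; rewrite /idx ?yE ?yO -?natr1 natr_val_Zp.
    by apply: (congr1 V); rewrite Zp_subKr.
  by apply: (congr1 W); rewrite subrK Zp_subKr.
- move=> m; rewrite -(odd_double_half m); case: odd => /= mn.
    by rewrite add1n yO ?idxV ?idxW Zp_subKr -natr1 addrK val_natr_Zp //; lia.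
  by rewrite add0n yE ?idxV ?idxW Zp_subKr val_natr_Zp //; lia.
- move=> m; rewrite /y oddD odd_double halfD odd_double add0n doubleK -addnS addFb.
  by rewrite !Zp_period.
- move=> Phi m; rewrite -doubleS !yE yO star_W.
  by rewrite -natr1 opprD addrA subrK.
- move=> Phi m; rewrite -doubleS !yO yE star_V.
  by rewrite -[m.+2%:R]natr1 opprD addrA.
by rewrite (yE 0%N) subr0.
Qed.

(** The numbering follows the cyclic order, because the double edge at $w_i$ leads to $v_{i+1}$. *)
Lemma removed_W i0 (B : set (gpoint G)) :
  (forall x, B x -> exists2 u, x = vpoint u & u <> W i0) -> ~ rank_determining B.
Proof.
move=> HB; pose y m := if odd m then V (i0 + m./2.+1%:R) else W (i0 + m./2%:R).
have yE m : y m.*2 = W (i0 + m%:R) by rewrite /y odd_double doubleK.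
have yO m : y m.*2.+1 = V (i0 + m.+1%:R).
  by rewrite /y /= odd_double /= uphalf_double.
pose idx (u : vertex G) : nat := match u with
  | inl j => (nat_of_ord (j - i0 - 1)%R).*2.+1 | inr j => (nat_of_ord (j - i0)%R).*2 end.
have idxV j : idx (V j) = (nat_of_ord (j - i0 - 1)).*2.+1 by [].
have idxW j : idx (W j) = (nat_of_ord (j - i0)).*2 by [].
apply: (@cyclic_not_rank_determining R G n.+2 y
  (fun m => wv true (i0 + m%:R)) (fun m => wv false (i0 + m%:R))
  (fun m => vw (i0 + m.+1%:R)) idx) => //.
- by case=> j; rewrite /idx; have := ltn_ord (j - i0); have := ltn_ord (j - i0 - 1); lia.
- case=> j; rewrite /idx ?yE ?yO -?natr1 natr_val_Zp.
    by apply: (congr1 V); rewrite subrK addrC subrK.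
  by apply: (congr1 W); rewrite addrC subrK.
- move=> m; rewrite -(odd_double_half m); case: odd => /= mn.
    by rewrite add1n yO ?idxV ?idxW Zp_addrKl -natr1 addrK val_natr_Zp //; lia.
  by rewrite add0n yE ?idxV ?idxW Zp_addrKl val_natr_Zp //; lia.
- move=> m; rewrite /y oddD odd_double halfD odd_double add0n doubleK -addnS addFb.
  by rewrite !Zp_period.
- move=> Phi m; rewrite -doubleS !yE yO star_V.
  by rewrite -natr1 addrA addrK.
- move=> Phi m; rewrite -doubleS !yO yE star_W.
  by rewrite -[m.+2%:R]natr1 addrA.
by rewrite (yE 0%N) addr0.
Qed.

End LoopOfLoops.

Theorem theorem1p3 (R : realType) (g : nat) (hg : (3 <= g)%N)
    (l : lol_edge g -> R) (l_gt0 : forall e : lol_edge g, 0 < l e) :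
  minimal_rank_determining (lol_vertices hg l_gt0).
Proof.
case: g hg l l_gt0 => [|[|[|n]]] // hg l l_gt0; split.
  rewrite (_ : lol_vertices hg l_gt0 = [set x | exists v, x = vpoint v]%classic).
    by apply: vertices_rank_determining => -[i|[i b]].
  apply/seteqP; split=> [x [i [->|->]]|x [[i|i] ->]]; try by eexists.
    by exists i; left.
  by exists i; right.
(* A proper subset misses some vertex, and the cyclic numbering is started there. *)
move=> B [BA /existsNP[x /not_implyP[[i xi] Bx]]].
have BV y : B y -> exists v, y = vpoint v.
  by move=> /BA[j [->|->]]; eexists.
case: xi Bx => -> Bi; [apply: (@removed_V _ _ _ _ _ i)|apply: (@removed_W _ _ _ _ _ i)];
  by move=> y By; have [v yv] := BV y By; exists v => // vi; apply: Bi; move: By; rewrite yv vi.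
Qed.
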